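(* Assume that $N(s)$, $s\ge 0$, is an OS-point process (order statistic point process). Fix $t>0$ and assume that the associated cumulative distribution function $F_t$ is absolutely continuous with density $f_t$. Let the distribution of each claim size $X_i$ depend on the claim arrival process only via the times $T_{i-1}$ and $T_i$, and let the distribution of each product $X_iX_j$ depend only on the times $T_{i-1},T_i,T_{j-1},T_j$. Then $$ \mathbf{E}[S^2(t)]=\sum_{n=1}^{\infty}\pi_{t,n}\big(A_{t,n}+2B_{t,n}\big), $$ where $$ A_{t,n}=n\int_0^t \mathbf{E}\big[X_1^2\,|\,T_1=y\big] f_t(y)(1-F_t(y))^{n-1}dy $$ $$ \quad+\sum_{i=2}^n\frac{n!}{(i-2)!(n-i)!}\int_0^t\int_0^y \mathbf{E}\big[X_i^2\,|\,T_{i-1}=x,T_i=y\big] f_t(x)f_t(y)F_t^{i-2}(x)(1-F_t(y))^{n-i}\,dx\,dy $$ and $$ B_{t,n}=n(n-1)\int_0^t\int_0^z \mathbf{E}\big[X_1X_2\,|\,T_1=y,T_2=z\big] f_t(y)f_t(z)(1-F_t(z))^{n-2}\,dy\,dz $$ $$ \quad+\sum_{j=3}^n\frac{n!}{(j-3)!(n-j)!}\int_0^t\int_0^z\int_0^w \mathbf{E}\big[X_1X_j\,|\,T_1=y,T_{j-1}=w,T_j=z\big] $$ $$ \qquad\qquad\times f_t(y)f_t(w)f_t(z)(F_t(w)-F_t(y))^{j-3}(1-F_t(z))^{n-j}\,dy\,dw\,dz $$ $$ \quad+\sum_{i=2}^{n-1}\frac{n!}{(i-2)!(n-i-1)!}\int_0^t\int_0^z\int_0^w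 \mathbf{E}\big[X_iX_{i+1}\,|\,T_{i-1}=y,T_i=w,T_{i+1}=z\big] $$ $$ \qquad\qquad\times f_t(y)f_t(w)f_t(z)F_t(y)^{i-2}(1-F_t(z))^{n-i-1}\,dy\,dw\,dz $$ $$ \quad+\sum_{i=2}^{n-2}\sum_{j=i+2}^n\frac{n!}{(i-2)!(j-i-2)!(n-j)!}\int_0^t\int_0^z\int_0^w\int_0^y \mathbf{E}\big[X_iX_j\,|\,T_{i-1}=x,T_i=y,T_{j-1}=w,T_j=z\big] $$ $$ \qquad\qquad\times f_t(x)f_t(y)f_t(w)f_t(z)F_t^{i-2}(x)(F_t(w)-F_t(y))^{j-i-2}(1-F_t(z))^{n-j}\,dx\,dy\,dw\,dz . $$
   Context: Setting. $0<T_1<T_2<\cdots$ are the claim arrival times, with $T_0=0$ (and $T_i=\infty$ if there are fewer than $i$ claims); $X_1,X_2,\dots$ are the corresponding claim sizes, which are nonnegative random variables, so that all expectations are well defined in $[0,\infty]$. $N(s)$ is the (finite) number of claims arriving up to and including time $s$, i.e. the largest integer $m$ with $T_m\le s$; $N(0)=0$ and $N$ is right-continuous with unit jumps at the $T_i$. The aggregate claim size is $S(t)=\sum_{i=1}^{N(t)}X_i$, with $S(t)=0$ when $N(t)=0$. Put $\pi_{t,n}=\mathbf{P}[N(t)=n]$. OS-point process: $N$ is an OS-point process if for every $t>0$ and every $n\ge 0$ with $\pi_{t,n}>0$, conditionally on $N(t)=n$, the arrival times $T_1,\dots,T_n$ have the same joint distribution as the order statistics of $n$ i.i.d. random variables with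 a common cumulative distribution function $F_t(x)$, $x\ge 0$ (depending on $t$ but not on $n$), such that $F_t(t)=1$. ''The distribution of $X_i$ (resp. $X_iX_j$, $i<j$) depends only on certain arrival times'' means: on $\{T_i<\infty\}$ (resp. $\{T_j<\infty\}$), its conditional distribution given the whole process $(N(s))_{s\ge0}$ is a function of those arrival times only. Conditional expectations such as $\mathbf{E}[X_iX_j|T_{i-1}=x,T_i=y,T_{j-1}=w,T_j=z]$ denote the corresponding regression functions. Empty sums are $0$, $0^0=1$, and the term with factor $n(n-1)$ is read as $0$ for $n=1$. *)

(* Defs.v *)
From HB Require Import structures.
From mathcomp Require Import all_boot all_order all_algebra.
From mathcomp Require Import all_classical all_reals all_analysis.
From mathcomp Require Import measurable_realfun.

Set Implicit Arguments.
Unset Strict Implicit.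
Unset Printing Implicit Defensive.

Import Order.TTheory GRing.Theory Num.Theory.
Import numFieldNormedType.Exports.

Local Open Scope classical_set_scope.
Local Open Scope ring_scope.
Local Open Scope ereal_scope.

(* Claims are numbered from 1: [tau i] and [X i] are the arrival time and the
   size of the [i]-th claim; [tau 0] is the origin and [X 0] is never used. *)
Record claim_arrivals d (Omega : measurableType d) (R : realType)
    (tau : nat -> {mfun Omega >-> \bar R}) (N : R -> Omega -> nat) : Prop :=
  ClaimArrivals {
    arrival0 : forall w, tau 0%N w = 0;
    arrival_lt : forall i w, tau i w < +oo -> tau i w < tau i.+1 w;
    arrival_oo : forall i w, tau i w = +oo -> tau i.+1 w = +oo;
    (* [N s w] is the largest [m] with [tau m w <= s]; in particular the
       arrivals do not accumulate *)
    count_le : forall s w, (0 <= s)%R -> tau (N s w) w <= s%:E;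
    count_max : forall s w m, (0 <= s)%R -> tau m w <= s%:E -> (m <= N s w)%N
  }.

(* Only meaningful where [tau i w] is finite. *)
Definition arrival_time d (Omega : measurableType d) (R : realType)
    (tau : nat -> {mfun Omega >-> \bar R}) (i : nat) (w : Omega) : R :=
  fine (tau i w).

Definition arrived d (Omega : measurableType d) (R : realType)
    (tau : nat -> {mfun Omega >-> \bar R}) (i : nat) : set Omega :=
  [set w | tau i w < +oo].

Definition aggregate_claim d (Omega : measurableType d) (R : realType)
    (X : nat -> {mfun Omega >-> R}) (N : R -> Omega -> nat)
    (t : R) (w : Omega) : R :=
  (\sum_(1 <= i < (N t w).+1) X i w)%R.

Definition count_prob d (Omega : measurableType d) (R : realType)
    (P : probability Omega R) (N : R -> Omega -> nat) (t : R) (n : nat) :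
    \bar R :=
  P [set w | N t w = n].

Definition cond_prob d (Omega : measurableType d) (R : realType)
    (P : probability Omega R) (A B : set Omega) : R :=
  (fine (P (A `&` B)) / fine (P B))%R.

Definition mutually_independent d (Omega : measurableType d) (R : realType)
    (Q : probability Omega R) (n : nat) (U : 'I_n -> {RV Q >-> R}) : Prop :=
  forall B : 'I_n -> set R, (forall k, measurable (B k)) ->
    Q [set w | forall k, B k (U k w)] = \prod_(k < n) Q (U k @^-1` B k).

Definition order_statistics d (Omega : measurableType d) (R : realType)
    (n : nat) (U : 'I_n -> Omega -> R) (w : Omega) : n.-tuple R :=
  [tuple of sort <=%R [tuple U k w | k < n]].

Definition OS_point_process d (Omega : measurableType d) (R : realType)
    (P : probability Omega R) (tau : nat -> {mfun Omega >-> \bar R})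
    (N : R -> Omega -> nat) (F : R -> cumulativeBounded (0 : R)%R (1 : R)%R) :
    Prop :=
  [/\ forall t x : R, (0 < t)%R -> (x < 0)%R -> F t x = 0%R,
      forall t : R, (0 < t)%R -> F t t = 1%R &
      forall (t : R) (n : nat), (0 < t)%R -> 0 < count_prob P N t n ->
        exists (d' : measure_display) (Omega' : measurableType d')
          (Q : probability Omega' R) (U : 'I_n -> {RV Q >-> R}),
        [/\ mutually_independent U,
            forall k x, cdf (U k) x = (F t x)%:E &
            forall B : set (n.-tuple R), measurable B ->
              cond_prob P
                [set w | B [tuple arrival_time tau k.+1 w | k < n]]
                [set w | N t w = n] =
              fine (Q [set w | B (order_statistics U w)])]].

Definition counting_sigma_algebra d (Omega : measurableType d) (R : realType)
    (N : R -> Omega -> nat) : set (set Omega) :=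
  <<s [set E | exists (s : R) (n : nat),
         (0 <= s)%R /\ E = [set w | N s w = n]] >>.

(* On [D], a regular conditional distribution of [Y] given the process [N] is
   [kappa (V w)]: it depends on the process only via [V]. *)
Definition cond_distribution_via d (Omega : measurableType d) (R : realType)
    (P : probability Omega R) (N : R -> Omega -> nat)
    d' (T' : measurableType d')
    (D : set Omega) (V : Omega -> T') (Y : Omega -> R) : Prop :=
  exists kappa : R.-pker T' ~> (measurableTypeR R),
    forall (E : set Omega) (B : set (measurableTypeR R)),
      counting_sigma_algebra N E -> E `<=` D -> measurable B ->
      P (E `&` Y @^-1` B) = \int[P]_(w in E) kappa (V w) B.

(* [g] is a version of the regression function v |-> E[Y | V = v], with
   values in [0, +oo]; [V] is only meaningful on [D]. *)
Definition regression_function d (Omega : measurableType d) (R : realType)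
    (P : probability Omega R) d' (T' : measurableType d')
    (D : set Omega) (V : Omega -> T') (Y : Omega -> R) (g : T' -> \bar R) :
    Prop :=
  [/\ measurable_fun [set: T'] g,
      forall v, 0 <= g v &
      forall B : set T', measurable B ->
        \int[P]_(w in D `&` V @^-1` B) (Y w)%:E =
        \int[P]_(w in D `&` V @^-1` B) g (V w)].

Definition has_density (R : realType) (F f : R -> R) : Prop :=
  [/\ measurable_fun [set: R] f,
      forall x, (0 <= f x)%R &
      forall x, (F x)%:E = \int[lebesgue_measure]_(y in `]-oo, x]) (f y)%:E].

Section Coefficients.
Variables (R : realType) (F f : R -> R) (t : R).
Local Notation mu := (@lebesgue_measure R).

(* [m1 y]        = E[X_1^2 | T_1 = y],
   [m2 i (x, y)] = E[X_i^2 | T_{i-1} = x, T_i = y]. *)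
Definition A_coef (m1 : R -> \bar R) (m2 : nat -> R * R -> \bar R) (n : nat) :
    \bar R :=
  n%:R%:E *
    (\int[mu]_(y in `[0%R, t]) (m1 y * (f y * (1 - F y) ^+ n.-1)%:E))
  + \sum_(2 <= i < n.+1)
      (n`!%:R / ((i - 2)`!%:R * (n - i)`!%:R))%:E *
      (\int[mu]_(y in `[0%R, t]) \int[mu]_(x in `[0%R, y])
         (m2 i (x, y) *
            (f x * f y * F x ^+ (i - 2) * (1 - F y) ^+ (n - i))%:E)).

(* [c12 (y, z)]         = E[X_1 X_2 | T_1 = y, T_2 = z],
   [c1 j (y, w, z)]     = E[X_1 X_j | T_1 = y, T_{j-1} = w, T_j = z],
   [cS i (y, w, z)]     = E[X_i X_{i+1} | T_{i-1} = y, T_i = w, T_{i+1} = z],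
   [c i j (x, y, w, z)] = E[X_i X_j | T_{i-1} = x, T_i = y,
                                      T_{j-1} = w, T_j = z]. *)
Definition B_coef (c12 : R * R -> \bar R) (c1 cS : nat -> R * R * R -> \bar R)
    (c : nat -> nat -> R * R * R * R -> \bar R) (n : nat) : \bar R :=
  (n * n.-1)%:R%:E *
    (\int[mu]_(z in `[0%R, t]) \int[mu]_(y in `[0%R, z])
       (c12 (y, z) * (f y * f z * (1 - F z) ^+ (n - 2))%:E))
  + \sum_(3 <= j < n.+1)
      (n`!%:R / ((j - 3)`!%:R * (n - j)`!%:R))%:E *
      (\int[mu]_(z in `[0%R, t]) \int[mu]_(w in `[0%R, z])
         \int[mu]_(y in `[0%R, w])
         (c1 j (y, w, z) *
            (f y * f w * f z * (F w - F y) ^+ (j - 3)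
               * (1 - F z) ^+ (n - j))%:E))
  + \sum_(2 <= i < n)
      (n`!%:R / ((i - 2)`!%:R * (n - i - 1)`!%:R))%:E *
      (\int[mu]_(z in `[0%R, t]) \int[mu]_(w in `[0%R, z])
         \int[mu]_(y in `[0%R, w])
         (cS i (y, w, z) *
            (f y * f w * f z * F y ^+ (i - 2)
               * (1 - F z) ^+ (n - i - 1))%:E))
  + \sum_(2 <= i < n.-1) \sum_(i.+2 <= j < n.+1)
      (n`!%:R / ((i - 2)`!%:R * (j - i - 2)`!%:R * (n - j)`!%:R))%:E *
      (\int[mu]_(z in `[0%R, t]) \int[mu]_(w in `[0%R, z])
         \int[mu]_(y in `[0%R, w]) \int[mu]_(x in `[0%R, y])
         (c i j (x, y, w, z) *
            (f x * f y * f w * f z * F x ^+ (i - 2)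
               * (F w - F y) ^+ (j - i - 2) * (1 - F z) ^+ (n - j))%:E)).

End Coefficients.

(* Main.v *)
Require Import Defs.
From HB Require Import structures.
From mathcomp Require Import all_boot all_order all_algebra fingroup perm.
From mathcomp Require Import all_classical all_reals all_analysis.
From mathcomp Require Import measurable_realfun ring zify.
Import Order.TTheory GRing.Theory Num.Theory.
Import numFieldNormedType.Exports.
Local Open Scope classical_set_scope.
Local Open Scope ring_scope.
Local Open Scope ereal_scope.

(** On {N(t) = n}, S(t)^2 is the sum of the X_i^2 and of twice the X_i X_j with
    i < j <= n, so the theorem evaluates E[X_i X_j ; N(t) = n], for i = j and for
    i < j. Two facts are used.

    The event {N(t) = n} belongs to the sigma-algebra of the process N, and the law
    of X_i X_j given N depends on T_{i-1}, T_i, T_{j-1}, T_j only. Hence, on this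
    event, X_i X_j may be replaced by its regression on those times, although the
    regression is defined by conditioning on them alone (integral_regression). All
    functions take values in [0, +oo] and may be non-integrable.

    On {N(t) = n}, (T_1, ..., T_n) is distributed as a sorted sample of size n from
    the density f (integral_arrivals_count). The n! orderings of a sample being
    equally likely and ties negligible, the mean of a function G of the sorted
    sample is n! times the integral of G(x) f(x_1) ... f(x_n) over the simplex
    0 <= x_1 <= ... <= x_n <= t (ge0_integral_iid_law_order_statistics). Here G
    depends on at most four of the coordinates. The k coordinates that lie between
    two consecutive marked values a and b integrate to (F b - F a)^k / k!: that is
    the volume of a simplex, again given by counting the orderings of k points
    (simplex_int_cst). Removing the unmarked coordinates from the top down
    (simplex_int_gap) turns the integral over the simplex into an iterated integral
    over the marked coordinates, weighted by those powers of F.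

    The six kinds of terms come from the coincidences among the marked times: T_0
    is 0, and T_i = T_{j-1} when j = i + 1 (sum_pairs_split). *)

Set Implicit Arguments.
Unset Strict Implicit.
Unset Printing Implicit Defensive.

(** * Integration of image measures and mixtures *)

Lemma ex_image_measure d d' (T : measurableType d) (T' : measurableType d')
    (R : realType) (m : {measure set T -> \bar R}) (phi : T -> T') :
  measurable_fun [set: T] phi ->
  exists m' : {measure set T' -> \bar R}, forall B, m' B = m (phi @^-1` B).
Proof. by move=> mphi; unshelve eexists (pushforward m phi). Qed.

Section mixture.
Context d1 d2 (X : measurableType d1) (Y : measurableType d2) (R : realType).
Variables (l : {measure set X -> \bar R}) (E : set X).
Variables (k : X -> {measure set Y -> \bar R}).
Hypothesis mE : measurable E.
Hypothesis mk : forall U, measurable U -> measurable_fun [set: X] (k ^~ U).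

Import HBNNSimple.

Lemma integral_mixture_nnsfun (g : {nnsfun Y >-> R}) :
  \int[l]_(x in E) \int[k x]_y (g y)%:E =
  \sum_(r \in range g) r%:E * \int[l]_(x in E) k x (g @^-1` [set r]).
Proof.
under eq_integral do rewrite integralT_nnsfun sintegralE.
rewrite ge0_integral_fsum//; last 2 first.
- by move=> r; apply/measurable_funTS/measurable_funeM; exact: mk.
- by move=> r x _; exact: nnsfun_mulemu_ge0.
apply: eq_fsbigr => r _.
have [r0|r0] := leP 0%R r.
  by rewrite ge0_integralZl//; exact/measurable_funTS/mk.
rewrite preimage_nnfun0// !integral0_eq ?mule0// => x _.
by rewrite measure0 mule0.
Qed.

Lemma integral_mixture_approx (G : Y -> \bar R) (G0 : forall y, 0 <= G y)
    (mG : measurable_fun [set: Y] G) (g := nnsfun_approx measurableT mG) :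
  \int[l]_(x in E) \int[k x]_y G y =
  limn (fun n => \int[l]_(x in E) \int[k x]_y (g n y)%:E).
Proof.
have gG x : \int[k x]_y (g n y)%:E @[n --> \oo] --> \int[k x]_y G y.
  rewrite (_ : \int[k x]_y G y = \int[k x]_y limn (fun n => (g n y)%:E)); last first.
    by apply: eq_integral => y _; apply/esym/cvg_lim => //; exact: cvg_nnsfun_approx.
  apply: cvg_monotone_convergence => //.
  - by move=> n; exact/measurable_EFinP.
  - by move=> n y _; rewrite lee_fin.
  - by move=> y _ a b ab; rewrite lee_fin; exact/lefP/nd_nnsfun_approx.
rewrite (eq_integral (fun x => limn (fun n => \int[k x]_y (g n y)%:E))); last first.
  by move=> x _; apply/esym/cvg_lim => //; exact: gG.
rewrite monotone_convergence//.
- move=> n; apply/measurable_funTS/measurable_fun_integral_kernel => //.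
    by move=> y; rewrite lee_fin.
  exact/measurable_EFinP.
- by move=> n x _; apply: integral_ge0 => y _; rewrite lee_fin.
- move=> x _ a b ab; apply: ge0_le_integral => //.
  + by move=> y _; rewrite lee_fin.
  + exact/measurable_EFinP.
  + exact/measurable_EFinP.
  + by move=> y _; rewrite lee_fin; exact/lefP/nd_nnsfun_approx.
Qed.

End mixture.

Section mixture_eq.

Import HBNNSimple.

(** Both sides are limits along the simple functions increasing to G, for which
    the hypothesis on sets suffices by linearity. *)
Lemma ge0_integral_mixture d1 d2 d3 (X : measurableType d1) (X' : measurableType d3)
    (Y : measurableType d2) (R : realType)
    (l : {measure set X -> \bar R}) (E : set X) (k : X -> {measure set Y -> \bar R})
    (l' : {measure set X' -> \bar R}) (E' : set X') (k' : X' -> {measure set Y -> \bar R})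
    (G : Y -> \bar R) :
  measurable E -> (forall U, measurable U -> measurable_fun [set: X] (k ^~ U)) ->
  measurable E' -> (forall U, measurable U -> measurable_fun [set: X'] (k' ^~ U)) ->
  (forall U, measurable U ->
    \int[l]_(x in E) k x U = \int[l']_(x in E') k' x U) ->
  (forall y, 0 <= G y) -> measurable_fun [set: Y] G ->
  \int[l]_(x in E) \int[k x]_y G y = \int[l']_(x in E') \int[k' x]_y G y.
Proof.
move=> mE mk mE' mk' kk' G0 mG.
rewrite (integral_mixture_approx l mE mk G0 mG) (integral_mixture_approx l' mE' mk' G0 mG).
congr (limn _); apply/funext => n; rewrite !integral_mixture_nnsfun//.
by apply: eq_fsbigr => r _; rewrite kk'.
Qed.

End mixture_eq.

(** Composing with phi is integrating against the kernel \d_(phi x), so that an image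
    measure is a mixture. *)
Lemma ge0_integral_image_eq d1 d2 d3 (X : measurableType d1) (X' : measurableType d3)
    (Y : measurableType d2) (R : realType)
    (l : {measure set X -> \bar R}) (E : set X) (phi : X -> Y)
    (l' : {measure set X' -> \bar R}) (E' : set X') (k' : X' -> {measure set Y -> \bar R})
    (G : Y -> \bar R) :
  measurable E -> measurable_fun [set: X] phi ->
  measurable E' -> (forall U, measurable U -> measurable_fun [set: X'] (k' ^~ U)) ->
  (forall U, measurable U ->
    l (E `&` phi @^-1` U) = \int[l']_(x in E') k' x U) ->
  (forall y, 0 <= G y) -> measurable_fun [set: Y] G ->
  \int[l]_(x in E) G (phi x) = \int[l']_(x in E') \int[k' x]_y G y.
Proof.
move=> mE mphi mE' mk' kk' G0 mG.
pose k x : {measure set Y -> \bar R} := \d_(phi x).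
have mphiU U : measurable U -> measurable (phi @^-1` U).
  by move=> mU; rewrite -[X in measurable X]setTI; exact: mphi.
have kE U x : k x U = (\1_(phi @^-1` U) x)%:E.
  by rewrite /k /= diracE indicE.
transitivity (\int[l]_(x in E) \int[k x]_y G y).
  by apply: eq_integral => x _; rewrite integral_dirac// diracT mul1e.
apply: ge0_integral_mixture => // U mU.
  under eq_fun do rewrite kE.
  by apply/measurable_EFinP/measurable_indic/mphiU.
under eq_integral do rewrite kE.
by rewrite integral_indic//; [rewrite setIC kk'|exact: mphiU].
Qed.

(** The identity m B = \int_B f dl reads m as a mixture of the measures f(x) \d_x. *)
Lemma ge0_integral_density d (T : measurableType d) (R : realType)
    (l m : {measure set T -> \bar R}) (f : T -> R) (D : set T) (G : T -> \bar R) :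
  measurable_fun [set: T] f -> (forall x, (0 <= f x)%R) ->
  (forall U, measurable U -> m U = \int[l]_(x in U) (f x)%:E) ->
  measurable D ->
  (forall y, 0 <= G y) -> measurable_fun [set: T] G ->
  \int[m]_(x in D) G x = \int[l]_(x in D) (G x * (f x)%:E).
Proof.
move=> mf f0 mE mD G0 mG.
pose k x : {measure set T -> \bar R} := mscale (NngNum (f0 x)) (\d_x).
have kE x U : measurable U -> k x U = (f x)%:E * (\1_U x)%:E.
  by move=> mU; rewrite /k /= /mscale /= diracE indicE.
rewrite (@ge0_integral_image_eq _ _ _ _ _ _ _ m D id l D k G)//.
- apply: eq_integral => x _; rewrite /k ge0_integral_mscale//=.
  by rewrite integral_dirac// diracT mul1e muleC.
- move=> U mU; under eq_fun do rewrite kE//.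
  apply: emeasurable_funM; first exact/measurable_EFinP.
  exact/measurable_EFinP/measurable_indic.
- move=> U mU; rewrite preimage_id mE; last exact: measurableI.
  rewrite integral_mkcondr; apply: eq_integral => x _.
  by rewrite kE// patchE indicE; case: ifP => _; rewrite ?mule1 ?mule0.
Qed.

(** * The law of an i.i.d. sample *)

Definition box (T : Type) n (B : 'I_n -> set T) : set (n.-tuple T) :=
  [set s | forall k, B k (tnth s k)].

Section boxes.
Context d (T : measurableType d) (n : nat).

Lemma measurable_box (B : 'I_n -> set T) :
  (forall k, measurable (B k)) -> measurable (box B).
Proof.
move=> mB; rewrite (_ : box B = \big[setI/setT]_(k < n) ((@tnth _ T ^~ k) @^-1` B k)).
  apply: bigsetI_measurable => k _; rewrite -[X in measurable X]setTI.
  exact: measurable_tnth.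
by rewrite -bigcap_seq; apply/seteqP; split=> [s sB k _|s sB k];
  [exact: sB|apply: (sB k); rewrite /= mem_index_enum].
Qed.

(** Boxes are stable under intersection and generate the product sigma-algebra. *)
Lemma tuple_measure_unique (R : realType)
    (m1 m2 : {measure set (n.-tuple T) -> \bar R}) :
  m1 setT < +oo ->
  (forall B, (forall k, measurable (B k)) -> m1 (box B) = m2 (box B)) ->
  forall A, measurable A -> m1 A = m2 A.
Proof.
move=> m1oo m12.
pose G := [set A | exists2 B : 'I_n -> set T, forall k, measurable (B k) & A = box B].
have GT : G setT.
  exists (fun=> setT); first by move=> k; exact: measurableT.
  by apply/seteqP; split.
apply: (measure_unique G (fun=> setT)) => //.
- apply/seteqP; split.
    apply: smallest_sub; first exact: smallest_sigma_algebra.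
    rewrite -bigcup_seq => A [i _ [B mB <-]]; apply: sub_sigma_algebra.
    exists (fun k => if k == i then B else setT).
      by move=> k; case: ifP => // _; exact: measurableT.
    rewrite setTI; apply/seteqP; split=> [s /= sB k|s /(_ i)]; last by rewrite eqxx.
    by case: ifP => // /eqP ->.
  apply: smallest_sub; first exact: sigma_algebra_measurable.
  by move=> A [B mB ->]; exact: measurable_box.
- move=> _ _ [A mA ->] [B mB ->]; exists (fun k => A k `&` B k).
    by move=> k; exact: measurableI.
  apply/seteqP; split=> [s [sA sB] k|s sAB]; first by split; [exact: sA|exact: sB].
  by split=> k; have [] := sAB k.
- by apply/seteqP; split=> // s _; exists 0%N.
- by move=> A [B mB ->]; exact: m12.
Qed.

Definition rcons_pair (p : n.-tuple T * T) : n.+1.-tuple T := rcons_tuple p.1 p.2.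

Lemma measurable_rcons : measurable_fun setT rcons_pair.
Proof.
apply/measurable_fun_tnthP => i.
have [ni|ni] := ltnP i n.
  rewrite (_ : _ \o _ = (fun p => tnth p.1 (Ordinal ni))).
    exact: (measurableT_comp (measurable_tnth _) measurable_fst).
  apply/funext => -[s x] /=; rewrite !(tnth_nth x)/=.
  by rewrite nth_rcons size_tuple ni.
rewrite (_ : _ \o _ = snd)//; apply/funext => -[s x] /=.
rewrite (tnth_nth x)/= nth_rcons size_tuple ltnNge ni/=.
by rewrite eqn_leq ni andbT -ltnS ltn_ord.
Qed.

Lemma measurable_rconsl x :
  measurable_fun setT (fun s : n.-tuple T => rcons_tuple s x).
Proof. exact: (measurableT_comp measurable_rcons (pair2_measurable x)). Qed.

HB.instance Definition _ := isMeasurableFun.Build _ _ _ _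
  rcons_pair measurable_rcons.

End boxes.

Section iid_law.
Context d (T : measurableType d) (R : realType) (nu : probability T R).

Fixpoint iid_law n : probability (n.-tuple T) R :=
  match n with
  | 0 => \d_[tuple]
  | n.+1 => distribution (iid_law n \x nu) (@rcons_pair _ T n)
  end.

Lemma iid_law_box n (B : 'I_n -> set T) : (forall k, measurable (B k)) ->
  iid_law n (box B) = \prod_(k < n) nu (B k).
Proof.
elim: n => [|n IH] in B * => mB.
  by rewrite big_ord0 /= diracE mem_set//; case.
rewrite big_ord_recr/= /distribution /pushforward.
pose B' (k : 'I_n) := B (widen_ord (leqnSn n) k).
rewrite (_ : _ @^-1` _ = box B' `*` B ord_max).
  rewrite product_measure1E//; last by apply: measurable_box => k; exact: mB.
  by rewrite -IH// => k; exact: mB.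
apply/seteqP; split=> -[s x] /=.
  move=> sB; split=> [k|].
    have := sB (widen_ord (leqnSn n) k).
    by rewrite !(tnth_nth x) /= nth_rcons size_tuple ltn_ord.
  have := sB ord_max.
  by rewrite !(tnth_nth x) /= nth_rcons size_tuple ltnn eqxx.
move=> [sB xB] k; rewrite (tnth_nth x) /= nth_rcons size_tuple.
case: ifPn => [kn|]; last first.
  rewrite -leqNgt => nk; rewrite (_ : k = ord_max) ?eqxx//.
  by apply/val_inj/eqP; rewrite /= eqn_leq nk -ltnS ltn_ord.
have := sB (Ordinal kn); rewrite (tnth_nth x) /B' /=.
by congr (B _ _); exact: val_inj.
Qed.

Lemma ge0_integral_iid_lawS n (G : n.+1.-tuple T -> \bar R) :
  measurable_fun setT G -> (forall s, 0 <= G s) ->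
  \int[iid_law n.+1]_s G s =
  \int[nu]_x \int[iid_law n]_s G (rcons_tuple s x).
Proof.
move=> mG G0 /=; rewrite ge0_integral_distribution//= fubini_tonelli2//=.
exact: (measurableT_comp mG (@measurable_rcons _ _ _)).
Qed.

(** A permuted sample gives every box the product of the same probabilities, in
    another order. *)
Lemma ge0_integral_iid_law_perm n (sigma : {perm 'I_n}) (G : n.-tuple T -> \bar R) :
  measurable_fun setT G -> (forall s, 0 <= G s) ->
  \int[iid_law n]_s G [tuple tnth s (sigma k) | k < n] = \int[iid_law n]_s G s.
Proof.
move=> mG G0.
pose phi (s : n.-tuple T) := [tuple tnth s (sigma k) | k < n].
have mphi : measurable_fun setT phi.
  apply/measurable_fun_tnthP => i.
  rewrite (_ : _ \o _ = @tnth _ T ^~ (sigma i)); first exact: measurable_tnth.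
  by apply/funext => s /=; rewrite tnth_mktuple.
pose Phi : {mfun n.-tuple T >-> n.-tuple T} :=
  HB.pack phi (isMeasurableFun.Build _ _ _ _ phi mphi).
rewrite -[LHS](@ge0_integral_distribution _ _ _ _ _ (iid_law n) Phi)//.
apply: eq_measure_integral => A mA _; apply: tuple_measure_unique mA.
  by rewrite /= /distribution /pushforward preimage_setT probability_setT ltry.
move=> B mB; rewrite [RHS]iid_law_box//.
transitivity (iid_law n (box (B \o (sigma^-1)%g))).
  congr (iid_law n _); apply/seteqP; split=> s /= sB k.
    by have := sB (sigma^-1 k)%g; rewrite /phi tnth_mktuple permKV.
  by have := sB (sigma k); rewrite /= /phi tnth_mktuple permK.
rewrite iid_law_box; last by move=> k; exact: mB.
by rewrite [RHS](reindex_inj (@perm_inj _ (sigma^-1)%g)).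
Qed.

End iid_law.

(** * Sorting an i.i.d. sample *)

Section sorted_rearrangement.
Context (R : realType) (n : nat).
Implicit Types s : n.-tuple R.

Definition rearrange (sigma : {perm 'I_n}) s : n.-tuple R :=
  [tuple tnth s (sigma k) | k < n].

Definition sort_tup s : n.-tuple R := [tuple of sort <=%R s].

Lemma sorted_sort_tup s : sorted <=%R (sort_tup s).
Proof. exact: (sort_sorted (@le_total _ R)). Qed.

Lemma rearrange_sorted_eq sigma s :
  sorted <=%R (rearrange sigma s) -> rearrange sigma s = sort_tup s.
Proof.
move=> ss; apply/val_inj/(sorted_eq le_trans le_anti) => //=; first exact: sorted_sort_tup.
rewrite perm_sym perm_sort perm_sym.
by apply/tuple_permP; exists sigma.
Qed.

Lemma ex_rearrange_sort s : exists sigma, rearrange sigma s = sort_tup s.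
Proof.
have /tuple_permP[sigma e] : perm_eq (sort_tup s) s by rewrite /= perm_sort.
by exists sigma; exact/val_inj/esym.
Qed.

(** Without ties exactly one rearrangement of s is sorted. *)
Lemma sum_sorted_rearrange (H : n.-tuple R -> \bar R) s : uniq s ->
  \sum_(sigma : {perm 'I_n})
     H (rearrange sigma s) * (sorted <=%R (rearrange sigma s))%:R%:E =
  H (sort_tup s).
Proof.
move=> us; have [sigma0 s0] := ex_rearrange_sort s.
rewrite (bigD1 sigma0)// big1; first by rewrite s0 sorted_sort_tup mule1 /= addr0.
move=> sigma; have [/rearrange_sorted_eq ss|_] := boolP (sorted _ _); last first.
  by rewrite mule0.
case/eqP; apply/permP => k; move/tuple_uniqP : us; apply.
have /(congr1 (@tnth _ R ^~ k)) := etrans ss (esym s0).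
by rewrite !tnth_mktuple.
Qed.

End sorted_rearrangement.

(** Throughout, the condition a <= s_1 <= ... <= s_n <= b is written
    [path <=%R a (rcons s b)]; it is stable under adjoining a largest element. *)
Lemma path_rcons_sortedE (R : realDomainType) (a b : R) (s : seq R) : (a <= b)%R ->
  path <=%R a (rcons s b) =
  sorted <=%R s && all (fun x => (a <= x <= b)%R) s.
Proof.
move=> ab; rewrite (path_pairwise le_trans) (sorted_pairwise le_trans) /=.
rewrite all_rcons ab pairwise_rcons /= andbA -all_predI andbC.
by congr (_ && _); apply: eq_all => x.
Qed.

Arguments rearrange : simpl never.
Arguments sort_tup : simpl never.

Section measurable_sort.
Context (R : realType).

Lemma measurable_sorted n :
  measurable [set s : n.-tuple R | sorted <=%R (s : seq R)].
Proof.
case: n => [|n].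
  rewrite (_ : [set _ | _] = setT); first exact: measurableT.
  by apply/seteqP; split=> // s _ /=; rewrite tuple0.
rewrite (_ : [set _ | _] = \big[setI/setT]_(i < n)
   [set s : n.+1.-tuple R | (tnth s (widen_ord (leqnSn n) i) <= tnth s (lift ord0 i))%R]).
  apply: bigsetI_measurable => i _.
  rewrite -[X in measurable X]setTI.
  by apply: measurable_fun_le => //; exact: measurable_tnth.
rewrite -bigcap_seq; apply/seteqP; split=> [s /= /(sortedP 0%R) ss i _|s ss].
  by rewrite /= !(tnth_nth 0%R)/=; apply: ss; rewrite size_tuple ltnS.
apply/(sortedP 0%R) => i; rewrite size_tuple ltnS => ni.
have := ss (Ordinal ni); rewrite /= !(tnth_nth 0%R)/=; apply.
by rewrite mem_index_enum.
Qed.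

Lemma measurable_rearrange n (sigma : {perm 'I_n}) :
  measurable_fun setT (@rearrange R n sigma).
Proof.
apply/measurable_fun_tnthP => i.
rewrite (_ : _ \o _ = @tnth _ R ^~ (sigma i)); first exact: measurable_tnth.
by apply/funext => s /=; rewrite tnth_mktuple.
Qed.

Lemma measurable_sort_tup n : measurable_fun setT (@sort_tup R n).
Proof.
move=> _ B mB; rewrite setTI.
rewrite (_ : _ @^-1` _ = \big[setU/set0]_(sigma : {perm 'I_n})
    (rearrange sigma @^-1` (B `&` [set s : n.-tuple R | sorted <=%R (s : seq R)]))).
  apply: bigsetU_measurable => sigma _; rewrite -[X in measurable X]setTI.
  by apply: measurable_rearrange => //; apply: measurableI => //; exact: measurable_sorted.
rewrite -bigcup_seq; apply/seteqP; split=> [s Bs|s [sigma _ []]].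
  have [sigma ss] := ex_rearrange_sort s.
  exists sigma; first by rewrite /= mem_index_enum.
  by rewrite /preimage /mkset ss; split=> //; exact: sorted_sort_tup.
by rewrite /preimage /mkset => Bs /rearrange_sorted_eq <-.
Qed.

End measurable_sort.

Section exchangeable_sort.
Context (R : realType).
Local Notation T := (measurableTypeR R).
Variable (nu : probability T R).
Hypothesis nu1 : forall x : R, nu [set x] = 0.

Lemma iid_law_coord n (k : 'I_n) (B : set T) : measurable B ->
  iid_law nu n (@tnth n T ^~ k @^-1` B) = nu B.
Proof.
move=> mB; rewrite (_ : _ @^-1` _ = box (fun i => if i == k then B else setT)).
  rewrite iid_law_box; last by move=> i; case: ifP.
  rewrite (bigD1 k)//= eqxx big1 ?mule1// => i /negPf ->.
  by rewrite probability_setT.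
apply/seteqP; split=> [s /= sB i|s /(_ k)]; last by rewrite /= eqxx.
by case: ifP => // /eqP ->.
Qed.

Lemma measurable_not_uniq n :
  measurable [set s : n.-tuple R | ~~ uniq (s : seq R)].
Proof.
rewrite (_ : [set _ | _] = \big[setU/set0]_(ij : 'I_n * 'I_n | ij.1 != ij.2)
   [set s : n.-tuple R | tnth s ij.1 = tnth s ij.2]).
  apply: bigsetU_measurable => -[i j] _.
  rewrite -[X in measurable X]setTI.
  have := @measurable_fun_eqr _ _ R setT (@tnth n R ^~ i) (@tnth n R ^~ j)
    (measurable_tnth _) (measurable_tnth _) measurableT [set true] I.
  by congr (measurable (_ `&` _)); apply/seteqP; split=> s /= /eqP.
rewrite -bigcup_seq_cond; apply/seteqP; split=> [s /= us|s [[i j] /= /andP[_ ij]] sij].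
  have [i [j [sij ij]]] : exists i j, tnth s i = tnth s j /\ i != j.
    apply: contrapT => ns; move/negP : us; apply; apply/tuple_uniqP => i j sij.
    by apply/eqP; apply: contrapT => /negP ij; apply: ns; exists i, j.
  by exists (i, j) => //=; rewrite mem_index_enum.
by apply/negP => /tuple_uniqP /(_ _ _ sij) /eqP; exact/negP.
Qed.

(** A new value x must avoid the n values already drawn; for each fixed x a
    coordinate equals x with probability 0. *)
Lemma iid_law_uniq n : iid_law nu n [set s : n.-tuple T | ~~ uniq (s : seq R)] = 0.
Proof.
elim: n => [|n IH].
  by rewrite (_ : [set _ | _] = set0) ?measure0//; apply/seteqP; split=> // s /=; rewrite tuple0.
have mN m : measurable [set s : m.-tuple T | ~~ uniq (s : seq R)].
  exact: measurable_not_uniq.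
rewrite -[X in iid_law _ _ X]setIT -integral_indic; [|exact: measurableT|exact: mN].
rewrite ge0_integral_iid_lawS; last 2 first.
- by apply/measurable_EFinP/measurable_indic; exact: mN.
- by move=> s; rewrite lee_fin.
apply: integral0_eq => x _.
pose A := [set s : n.-tuple T | ~~ uniq (rcons_tuple s x : seq R)].
have mA : measurable A.
  have := @measurable_rconsl _ T n x measurableT _ (mN n.+1).
  by rewrite setTI.
rewrite (_ : (fun _ => _) = fun s => (\1_A s)%:E)//.
rewrite integral_indic// setIT.
apply: measure_negligible => //.
apply: (@negligibleS _ _ _ _ ([set s : n.-tuple T | ~~ uniq (s : seq R)] `|`
    \bigcup_k [set s : n.-tuple T | (k < n)%N /\ nth x s k = x])).
  move=> s; rewrite /A /mkset /= rcons_uniq negb_and negbK => /orP[xs|us]; last by left.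
  right; exists (index x s) => //; split; last exact: nth_index.
  by rewrite -[X in (_ < X)%N](size_tuple s) index_mem.
apply: negligibleU; first by apply/negligibleP => //; exact: mN.
apply: negligible_bigcup => k.
have [kn|kn] := ltnP k n; last first.
  by rewrite (_ : mkset _ = set0); [exact: negligible_set0|apply/seteqP; split=> // s []].
apply: (@negligibleS _ _ _ _ (@tnth n T ^~ (Ordinal kn) @^-1` [set x])).
  by move=> s [_ sx] /=; rewrite (tnth_nth x).
apply/negligibleP; last exact: (etrans (iid_law_coord (Ordinal kn) (measurable_set1 x)) (nu1 x)).
by rewrite -[X in measurable X]setTI; exact: measurable_tnth.
Qed.

(** H(sort s) is the sum over the permutations sigma of H(s o sigma) on the event
    that s o sigma is sorted, and all the n! terms have the same integral. *)
Lemma ge0_integral_iid_law_sort n (H : n.-tuple T -> \bar R) :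
  measurable_fun setT H -> (forall s, 0 <= H s) ->
  \int[iid_law nu n]_s H (sort_tup s) =
  n`!%:R%:E * \int[iid_law nu n]_s (H s * (sorted <=%R (s : seq R))%:R%:E).
Proof.
move=> mH H0.
pose HS s := H s * (sorted <=%R (s : seq R))%:R%:E.
have mHS : measurable_fun setT HS.
  apply: emeasurable_funM => //; apply/measurable_EFinP.
  rewrite (_ : (fun _ => _) = \1_[set s : n.-tuple T | sorted <=%R (s : seq R)]).
    by apply: measurable_indic; exact: (@measurable_sorted R n).
  by apply/funext => s; rewrite indicE mem_setE.
have HS0 s : 0 <= HS s by rewrite mule_ge0// lee_fin.
have mHSr sigma : measurable_fun setT (fun s => HS (rearrange sigma s)).
  exact: (measurableT_comp mHS (@measurable_rearrange R n sigma)).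
transitivity (\int[iid_law nu n]_s \sum_(sigma : {perm 'I_n}) HS (rearrange sigma s)).
  apply: ge0_ae_eq_integral => //.
  - exact: (measurableT_comp mH (@measurable_sort_tup R n)).
  - by apply: emeasurable_sum => sigma; exact: mHSr.
  - by move=> s _; apply: sume_ge0.
  - exists [set s : n.-tuple T | ~~ uniq (s : seq R)]; split.
    + exact: measurable_not_uniq.
    + exact: iid_law_uniq.
    + move=> s /=; apply: contra_notN => us _; rewrite /HS.
      by rewrite (sum_sorted_rearrange H us).
rewrite ge0_integral_sum//.
under eq_bigr do rewrite (ge0_integral_iid_law_perm _ _ mHS HS0).
by rewrite sumr_const card_Sn mule_natl.
Qed.

End exchangeable_sort.

(** * Integrals over simplices *)

Section chain.
Context (R : realType).
Local Notation T := (measurableTypeR R).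

Lemma measurable_chain a n : measurable_fun setT
  (fun p : n.-tuple T * T => (path <=%R a (rcons p.1 p.2 : seq R))%:R%:E : \bar R).
Proof.
pose S := [set p : n.-tuple T * T | path <=%R a (rcons p.1 p.2 : seq R)].
apply/measurable_EFinP; rewrite (_ : (fun _ => _) = \1_S); last first.
  by apply/funext => p; rewrite indicE mem_setE.
apply: measurable_indic.
have := measurable_cons (@measurable_cst _ _ _ _ setT (a : T)) (@measurable_rcons _ T n).
by move=> /(_ measurableT _ (@measurable_sorted R n.+2)); rewrite setTI.
Qed.

Lemma measurable_chainl a n b : measurable_fun setT
  (fun s : n.-tuple T => (path <=%R a (rcons s b : seq R))%:R%:E : \bar R).
Proof. exact: (measurableT_comp (@measurable_chain a n) (pair2_measurable b)). Qed.

Lemma path_rcons_ge (a b : R) s : path <=%R a (rcons s b) -> (a <= b)%R.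
Proof.
by rewrite (path_sortedE le_trans) all_rcons => /andP[/andP[]].
Qed.

End chain.

Section simplex_integral.
Context (R : realType).
Local Notation T := (measurableTypeR R).
Local Notation mu := (@lebesgue_measure R).
Variable f : R -> R.

(** The integral of G(x_1, ..., x_n) f(x_1) ... f(x_n) over the simplex
    a <= x_1 <= ... <= x_n <= b, the largest variable being outermost. *)
Fixpoint simplex_int (a : R) n (b : R) (G : seq R -> \bar R) : \bar R :=
  if n is m.+1 then
    \int[mu]_(x in `[a, b]) ((f x)%:E * simplex_int a m x (fun s => G (rcons s x)))
  else G [::].

Hypotheses (mf : measurable_fun [set: R] f) (f0 : forall x, (0 <= f x)%R).
Variable nu : probability T R.
Hypothesis nuf : forall U : set T, measurable U -> nu U = \int[mu]_(x in U) (f x)%:E.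

Lemma density_atomless x : nu [set x] = 0.
Proof.
rewrite nuf//; apply: null_set_integral => //.
  exact/measurable_EFinP/measurable_funTS.
exact: lebesgue_measure_set1.
Qed.

(** Integrating the last coordinate x outermost, the chain a <= s_1 <= ... <= x <= b
    leaves a chain from a to x for the other coordinates. *)
Lemma ge0_integral_iid_law_chain a n b (G : seq R -> \bar R) : (a <= b)%R ->
  (forall s, 0 <= G s) -> measurable_fun setT (fun s : n.-tuple T => G s) ->
  \int[iid_law nu n]_s (G s * (path <=%R a (rcons s b : seq R))%:R%:E) =
  simplex_int a n b G.
Proof.
elim: n => [|n IH] in b G *; move=> ab G0 mG.
  rewrite /= integral_dirac//=; first by rewrite diracT mul1e andbT ab mule1.
  by apply: emeasurable_funM => //; exact: measurable_chainl.
pose H x := \int[iid_law nu n]_s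
  (G (rcons s x) * (path <=%R a (rcons s x : seq R))%:R%:E).
have mGr : measurable_fun setT (fun p : n.-tuple T * T => G (rcons p.1 p.2)).
  exact: (measurableT_comp mG (@measurable_rcons _ T n)).
have mH : measurable_fun setT H.
  apply: (@measurable_fun_fubini_tonelli_G _ _ _ _ _ (iid_law nu n) (fun p =>
    G (rcons p.1 p.2) * (path <=%R a (rcons p.1 p.2 : seq R))%:R%:E)) => //.
  - by apply: emeasurable_funM => //; exact: measurable_chain.
  - by move=> p; rewrite mule_ge0// lee_fin.
have H0 x : 0 <= H x.
  by apply: integral_ge0 => s _; rewrite mule_ge0// lee_fin.
rewrite ge0_integral_iid_lawS; last 2 first.
- by apply: emeasurable_funM => //; exact: measurable_chainl.
- by move=> s; rewrite mule_ge0// lee_fin.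
transitivity (\int[nu]_(x in `[a, b]) H x).
  rewrite [RHS]integral_mkcond; apply: eq_integral => x _; rewrite patchE.
  case: ifPn => [|xab].
    rewrite inE /= in_itv/= => /andP[ax xb]; apply: eq_integral => s _ /=.
    by rewrite [in X in X%:R]rcons_path last_rcons xb andbT.
  apply: integral0_eq => s _ /=.
  rewrite [in X in X%:R]rcons_path last_rcons.
  case: (boolP (path _ _ _ && _)) => /= [/andP[/path_rcons_ge ax xb]|_]; last by rewrite mule0.
  by move/negP : xab; case; rewrite inE /= in_itv/= ax xb.
rewrite (@ge0_integral_density _ _ _ mu nu f)//=.
apply: eq_integral => x; rewrite inE /= in_itv/= => /andP[ax xb].
rewrite muleC /H (IH x (fun s => G (rcons s x)))//.
exact: (measurableT_comp mGr (pair2_measurable x)).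
Qed.

End simplex_integral.

Section simplex_calculus.
Context (R : realType).
Local Notation T := (measurableTypeR R).
Local Notation mu := (@lebesgue_measure R).
Variables f F : R -> R.
Hypotheses (mf : measurable_fun [set: R] f) (f0 : forall x, (0 <= f x)%R).
Variable nu : probability T R.
Hypothesis nuf : forall U : set T, measurable U -> nu U = \int[mu]_(x in U) (f x)%:E.
Hypothesis nuF : forall x : R, nu [set` `]-oo, x]] = (F x)%:E.

Let nu1 x : nu [set x] = 0. Proof. exact: density_atomless nuf x. Qed.

Lemma law_itvcc a b : (a <= b)%R -> nu [set` `[a, b]] = (F b - F a)%:E.
Proof.
move=> ab; rewrite EFinB -!nuF.
have -> : `[a, b]%classic = [set a] `|` (`]-oo, b]%classic `\` `]-oo, a]%classic).
  apply/seteqP; split=> x; rewrite /= !in_itv/=.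
    move=> /andP[ax xb]; have [->|xa] := eqVneq x a; first by left.
    by right; split=> //; apply/negP; rewrite -ltNge lt_neqAle eq_sym xa.
  by move=> [->|[xb /negP]]; rewrite ?lexx ?ab// -ltNge => /ltW -> /=.
rewrite setUC measureU0//; [|exact: measurableD|exact: nu1].
rewrite measureD//; last by rewrite ltey_eq fin_num_measure.
by rewrite setIidr//; exact: subset_itvl.
Qed.

Lemma cdf_le a b : (a <= b)%R -> (F a <= F b)%R.
Proof.
by move=> ab; rewrite -lee_fin -!nuF le_measure ?inE//; exact: subset_itvl.
Qed.

Lemma measurable_cdf : measurable_fun setT F.
Proof. by apply: nondecreasing_measurable => // a b; exact: cdf_le. Qed.

Lemma simplex_int_ext a n b G G' : (forall s, size s = n -> G s = G' s) ->
  simplex_int f a n b G = simplex_int f a n b G'.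
Proof.
elim: n => [|n IH] in b G G' * => GG'; first exact: GG'.
apply: eq_integral => x _; congr *%E.
by apply: IH => s sn; apply: GG'; rewrite size_rcons sn.
Qed.

Lemma simplex_int_ge0 a n b G : (forall s, 0 <= G s) -> 0 <= simplex_int f a n b G.
Proof.
elim: n => [|n IH] in b G * => G0 //=; apply: integral_ge0 => x _.
by rewrite mule_ge0 ?lee_fin//; exact: IH.
Qed.

Lemma simplex_intZr a n b (c : R) (G : seq R -> \bar R) : (a <= b)%R -> (0 <= c)%R ->
  (forall s, 0 <= G s) -> measurable_fun setT (fun s : n.-tuple T => G s) ->
  simplex_int f a n b (fun s => G s * c%:E) = simplex_int f a n b G * c%:E.
Proof.
move=> ab c0 G0 mG.
have GcE := ge0_integral_iid_law_chain mf f0 nuf (G := fun s => G s * c%:E) ab.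
rewrite -GcE; last 2 first.
- by move=> s; rewrite mule_ge0// lee_fin.
- exact: emeasurable_funM.
rewrite -(ge0_integral_iid_law_chain mf f0 nuf ab G0 mG).
rewrite -ge0_integralZr//.
- by apply: eq_integral => s _; rewrite muleAC.
- by apply: emeasurable_funM => //; exact: measurable_chainl.
- by move=> s _; rewrite mule_ge0// lee_fin.
Qed.

(** The volume of the simplex: n points of the sample fall in [a, b] with probability
    (F b - F a)^n, and are then equally likely to come in any of the n! orders. *)
Lemma simplex_int_cst a n b (c : \bar R) : (a <= b)%R -> 0 <= c ->
  simplex_int f a n b (cst c) = c * ((F b - F a) ^+ n / n`!%:R)%:E.
Proof.
move=> ab c0.
rewrite -(ge0_integral_iid_law_chain mf f0 nuf)//.
pose I (s : n.-tuple T) := (all (fun x => (a <= x <= b)%R) (s : seq R))%:R%:E : \bar R.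
have IE : I = fun s => (\1_(box (fun=> `[a, b]%classic)) s)%:E.
  apply/funext => s; rewrite /I indicE.
  rewrite (_ : (s \in _) = all (fun x => (a <= x <= b)%R) (s : seq R))//.
  apply/idP/allP => [/set_mem sab x /tnthP[k ->]|sab].
    by have := sab k; rewrite /= in_itv.
  by apply/mem_set => k; rewrite /= in_itv/=; apply: sab; exact: mem_tnth.
have mI : measurable_fun setT I.
  rewrite IE; apply/measurable_EFinP/measurable_indic.
  exact: (measurable_box (fun=> measurable_itv _)).
pose H s := c * I s.
have mH : measurable_fun setT H by exact: emeasurable_funM.
have H0 s : 0 <= H s by rewrite mule_ge0// lee_fin.
have Hsort s : H (sort_tup s) = H s by rewrite /H /I /= all_sort.
have chainE (s : n.-tuple T) : c * (path <=%R a (rcons s b : seq R))%:R%:E =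
    H s * (sorted <=%R (s : seq R))%:R%:E.
  by rewrite path_rcons_sortedE// /H /I -muleA -EFinM -natrM mulnb andbC.
rewrite /cst; under eq_integral do rewrite chainE.
set J := \int[_]_s _.
have HJ : \int[iid_law nu n]_s H s = n`!%:R%:E * J.
  rewrite -(ge0_integral_iid_law_sort nu1 mH H0).
  by apply: eq_integral => s _; rewrite Hsort.
have HF : \int[iid_law nu n]_s H s = c * ((F b - F a) ^+ n)%:E.
  rewrite ge0_integralZl//; last by move=> s _; rewrite lee_fin.
  transitivity (c * \int[iid_law nu n]_s (\1_(box (fun=> `[a, b]%classic)) s)%:E).
    by rewrite IE.
  rewrite integral_indic//; last exact: (measurable_box (fun=> measurable_itv _)).
  rewrite setIT; congr (c * _).
  rewrite [LHS](iid_law_box nu (fun=> measurable_itv _)).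
  under eq_bigr do rewrite law_itvcc//.
  elim: n {I IE mI H mH H0 Hsort chainE J HJ} => [|n IH]; first by rewrite big_ord0.
  by rewrite big_ord_recr/= IH -EFinM exprSr.
by rewrite EFinM muleA -HF HJ muleAC -EFinM mulfV ?mul1e//.
Qed.

(** The integrand depends on the m.+1 smallest variables only, z being the largest of
    these; the k variables above z contribute the volume of the simplex between z
    and b. By induction on k: exchange the integrals over z and over the largest
    variable y, and use that the integral of f(y) (F y - F z)^k / k! over [z, b] is
    the next volume. *)
Lemma simplex_int_gap a m k b (H : seq R -> R -> \bar R) : (a <= b)%R ->
  (forall s x, 0 <= H s x) ->
  measurable_fun setT (fun p : m.-tuple T * T => H p.1 p.2) ->
  simplex_int f a (k + m.+1)%N b (fun s => H (take m s) (nth 0%R s m)) =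
  \int[mu]_(z in `[a, b])
    (simplex_int f a m z (H ^~ z) * (f z * ((F b - F z) ^+ k / k`!%:R))%:E).
Proof.
move=> + H0 mH; elim: k b => [|k IH] b ab.
  rewrite add0n /=; apply: eq_integral => z _.
  rewrite expr0 divr1 mulr1 muleC; congr (_ * _).
  apply: simplex_int_ext => s sm.
  by rewrite -{1}sm -cats1 take_size_cat// nth_cat sm ltnn subnn.
pose h z := \int[iid_law nu m]_s (H s z * (path <=%R a (rcons s z : seq R))%:R%:E).
have mHc : measurable_fun setT (fun p : m.-tuple T * T =>
    H p.1 p.2 * (path <=%R a (rcons p.1 p.2 : seq R))%:R%:E).
  by apply: emeasurable_funM => //; exact: measurable_chain.
have Hc0 (p : m.-tuple T * T) :
    0 <= H p.1 p.2 * (path <=%R a (rcons p.1 p.2 : seq R))%:R%:E.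
  by rewrite mule_ge0// lee_fin.
have mh : measurable_fun setT h.
  exact: (@measurable_fun_fubini_tonelli_G _ _ _ _ _ (iid_law nu m) _ mHc Hc0).
have h0 z : 0 <= h z.
  by apply: integral_ge0 => s _; exact: (Hc0 (s, z)).
have hE z : (a <= z)%R -> simplex_int f a m z (H ^~ z) = h z.
  move=> az; rewrite -(ge0_integral_iid_law_chain mf f0 nuf az)//.
  exact: (measurableT_comp mH (pair2_measurable z)).
rewrite addSn.
pose S := [set p : T * T | (a <= p.2 <= p.1)%R /\ (p.1 <= b)%R].
have mS : measurable S.
  rewrite (_ : S = [set p | (a <= p.2)%R] `&` [set p | (p.2 <= p.1)%R] `&`
      [set p | (p.1 <= b)%R]); last first.
    apply/seteqP; split=> p; first by move=> [/andP[ap pp] pb]; split.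
    by move=> [[ap pp] pb]; split=> //; apply/andP.
  have mle (g1 g2 : T * T -> R) : measurable_fun setT g1 -> measurable_fun setT g2 ->
      measurable [set p | (g1 p <= g2 p)%R].
    by move=> m1 m2; rewrite -[X in measurable X]setTI; exact: measurable_fun_le.
  have mp1 : measurable_fun setT (fun p : T * T => p.1 : R) by exact: measurable_fst.
  have mp2 : measurable_fun setT (fun p : T * T => p.2 : R) by exact: measurable_snd.
  by apply: measurableI; [apply: measurableI|];
    [exact: (mle (cst a)) | exact: mle | exact: (mle _ (cst b))].
pose w (p : T * T) := (f p.1 * (f p.2 * ((F p.1 - F p.2) ^+ k / k`!%:R)))%R.
have mw : measurable_fun setT w.
  have mc1 (g : R -> R) : measurable_fun setT g ->
      measurable_fun setT (fun p : T * T => g p.1).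
    by move=> mg; exact: (measurableT_comp mg (@measurable_fst _ _ T T)).
  have mc2 (g : R -> R) : measurable_fun setT g ->
      measurable_fun setT (fun p : T * T => g p.2).
    by move=> mg; exact: (measurableT_comp mg (@measurable_snd _ _ T T)).
  apply: measurable_funM; first exact: mc1.
  apply: measurable_funM; first exact: mc2.
  apply: measurable_funM => //; apply: measurable_funX.
  by apply: measurable_funB; [exact: (mc1 F measurable_cdf)|exact: (mc2 F measurable_cdf)].
have w0 p : S p -> (0 <= w p)%R.
  move=> [/andP[_ p21] _].
  by rewrite !mulr_ge0// ?exprn_ge0 ?subr_ge0 ?cdf_le// invr_ge0.
(* Phi is the integrand over the triangle a <= z <= y <= b, where p = (y, z). *)
pose Phi (p : T * T) := h p.2 * (w p * \1_S p)%:E.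
have mPhi : measurable_fun setT Phi.
  apply: emeasurable_funM; first exact: (measurableT_comp mh measurable_snd).
  by apply/measurable_EFinP/measurable_funM => //; exact: measurable_indic.
have Phi0 p : 0 <= Phi p.
  rewrite mule_ge0// lee_fin indicE.
  by case: (boolP (p \in S)) => [/set_mem/w0 ? | _]; rewrite ?mulr1 ?mulr0.
transitivity (\int[mu]_y \int[mu]_z Phi (y, z)).
  rewrite [LHS]/= integral_mkcond; apply: eq_integral => y _; rewrite patchE.
  case: ifPn => [/set_mem|yab]; last first.
    rewrite integral0_eq// => z _; rewrite /Phi indicE memNset ?mulr0 ?mule0//.
    by move=> [/andP[/= az zy] yb]; move/negP: yab; apply; rewrite inE /= in_itv/= yb (le_trans az).
  rewrite /= in_itv/= => /andP[ay yb].
  rewrite (@simplex_int_ext _ _ _ _ (fun s => H (take m s) (nth 0%R s m))); last first.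
    move=> s ss; have sm : (m < size s)%N by rewrite ss addnS ltnS leq_addl.
    by rewrite -cats1 takel_cat ?(ltnW sm)// nth_cat sm.
  rewrite IH// (_ : integral _ _ _ =
      \int[mu]_(z in `[a, y]) (h z * (f z * ((F y - F z) ^+ k / k`!%:R))%:E)); last first.
    by apply: eq_integral => z; rewrite inE /= in_itv/= => /andP[az _]; rewrite hE.
  rewrite -ge0_integralZl//; last 3 first.
  - apply/measurable_funTS/emeasurable_funM => //; apply/measurable_EFinP.
    apply: measurable_funM => //; apply: measurable_funM => //.
    by apply/measurable_funX/measurable_funB => //; exact: measurable_cdf.
  - move=> z; rewrite /= in_itv/= => /andP[_ zy]; rewrite mule_ge0// lee_fin.
    by rewrite !mulr_ge0// exprn_ge0// subr_ge0 cdf_le.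
  - by rewrite lee_fin.
  rewrite integral_mkcond; apply: eq_integral => z _; rewrite patchE.
  case: ifPn => [/set_mem|zay].
    rewrite /= in_itv/= => /andP[az zy]; rewrite /Phi indicE mem_set; last first.
      by rewrite /S/= az zy.
    by rewrite mulr1 muleCA -EFinM.
  rewrite /Phi indicE memNset ?mulr0 ?mule0//.
  by move=> [/= azy _]; move/negP : zay; apply; rewrite inE /= in_itv.
rewrite (fubini_tonelli (m1 := mu) (m2 := mu) Phi)// [RHS]integral_mkcond.
apply: eq_integral => z _; rewrite patchE.
case: ifPn => [/set_mem|zab]; last first.
  rewrite integral0_eq// => y _; rewrite /Phi indicE memNset ?mulr0 ?mule0//.
  by move=> [/andP[/= az zy] yb]; move/negP: zab; apply; rewrite inE /= in_itv/= az (le_trans zy).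
rewrite /= in_itv/= => /andP[az zb].
rewrite hE//.
transitivity (\int[mu]_(y in `[z, b])
    ((h z * (f z)%:E) * ((f y)%:E * simplex_int f z k y (cst 1)))).
  rewrite [RHS]integral_mkcond; apply: eq_integral => y _; rewrite patchE.
  case: ifPn => [/set_mem|zyb].
    rewrite /= in_itv/= => /andP[zy yb]; rewrite /Phi indicE mem_set; last first.
      by rewrite /S/= az zy.
    rewrite simplex_int_cst// mul1e mulr1 -muleA -!EFinM; congr (_ * _%:E).
    by rewrite /w /= mulrCA.
  rewrite /Phi indicE memNset ?mulr0 ?mule0//.
  by move=> [/andP[/= _ zy] yb]; move/negP : zyb; apply; rewrite inE /= in_itv/= zy.
rewrite ge0_integralZl//; last 3 first.
- apply: (eq_measurable_fun (fun y => (f y * ((F y - F z) ^+ k / k`!%:R))%:E)).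
    move=> y; rewrite inE /= in_itv/= => /andP[zy _].
    by rewrite simplex_int_cst// mul1e EFinM.
  apply/measurable_funTS/measurable_EFinP/measurable_funM => //.
  apply: measurable_funM => //; apply/measurable_funX/measurable_funB => //.
  exact: measurable_cdf.
- move=> y _; rewrite mule_ge0// ?lee_fin//.
  by apply: simplex_int_ge0 => s; rewrite lee_fin.
- by rewrite mule_ge0// lee_fin.
have := @simplex_int_cst z k.+1 b 1 zb.
by rewrite /= mul1e => ->//; rewrite -muleA -EFinM.
Qed.

End simplex_calculus.

(** * Integrals of functions of a few order statistics *)

Arguments simplex_int : simpl never.

Section marked_order_statistics.
Context (R : realType).
Local Notation T := (measurableTypeR R).
Local Notation mu := (@lebesgue_measure R).
Variables f F : R -> R.
Hypotheses (mf : measurable_fun [set: R] f) (f0 : forall x, (0 <= f x)%R).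
Variable nu : probability T R.
Hypothesis nuf : forall U : set T, measurable U -> nu U = \int[mu]_(x in U) (f x)%:E.
Hypothesis nuF : forall x : R, nu [set` `]-oo, x]] = (F x)%:E.

Lemma measurable_nth m i :
  measurable_fun setT (fun s : m.-tuple T => nth 0%R s i : R).
Proof.
have [im|im] := ltnP i m; last first.
  rewrite (_ : (fun _ => _) = cst 0%R)//; apply/funext => s /=.
  by rewrite nth_default// size_tuple.
rewrite (_ : (fun _ => _) = @tnth _ T ^~ (Ordinal im)); first exact: measurable_tnth.
by apply/funext => s /=; rewrite (tnth_nth 0%R).
Qed.

Lemma measurable_nth_fst m i :
  measurable_fun setT (fun p : m.-tuple T * T => nth 0%R p.1 i : R).
Proof. exact: (measurableT_comp (@measurable_nth m i) measurable_fst). Qed.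

(** The weight of z is carried inside the remaining integral, so that iterating the
    lemma accumulates all the weights in the innermost integrand. *)
Lemma simplex_int_gap_weighted a m k b n (G : seq R -> \bar R) (H : seq R -> R -> \bar R) : (a <= b)%R ->
  n = (k + m.+1)%N ->
  (forall s, G s = H (take m s) (nth 0%R s m)) ->
  (forall s x, 0 <= H s x) ->
  measurable_fun setT (fun p : m.-tuple T * T => H p.1 p.2) ->
  simplex_int f a n b G =
  \int[mu]_(z in `[a, b])
    simplex_int f a m z (fun s => H s z * (f z * ((F b - F z) ^+ k / k`!%:R))%:E).
Proof.
move=> ab -> GH H0 mH.
rewrite (simplex_int_ext f a b (fun s _ => GH s)).
rewrite (simplex_int_gap mf f0 nuf nuF _ ab H0 mH).
apply: eq_integral => z; rewrite inE /= in_itv/= => /andP[az zb].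
rewrite (simplex_intZr mf f0 nuf az)//.
- by rewrite !mulr_ge0// exprn_ge0// subr_ge0 (cdf_le nuF).
- exact: (measurableT_comp mH (pair2_measurable z)).
Qed.

Variable t : R.
Hypotheses (t0 : (0 <= t)%R) (F0 : F 0 = 0%R) (Ft : F t = 1%R).

(** C is a product of factorials that cancels the denominators of the volumes. *)
Lemma simplex_int_coef n (C : R) (G : seq R -> \bar R) I : (0 < C)%R ->
  (forall s, 0 <= G s) ->
  measurable_fun setT (fun s : n.-tuple T => G s) ->
  simplex_int f 0 n t (fun s => G s * C%:E) = I ->
  n`!%:R%:E * simplex_int f 0 n t G = (n`!%:R / C)%:E * I.
Proof.
move=> C0 G0 mG <-; rewrite (simplex_intZr mf f0 nuf t0)//; last exact: ltW.
rewrite [X in _ = _ * X]muleC muleA -EFinM divfK//; exact: lt0r_neq0.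
Qed.

Let fact_neq0 n : (n`!%:R != 0 :> R)%R.
Proof. by rewrite pnatr_eq0 -lt0n fact_gt0. Qed.

(** In this lemma and the next ones p, r and q are the numbers of unmarked variables below the
    first marked one, in the inner gap and above the last marked one. *)
Lemma mean_one_order_statistic q (g : R -> \bar R) :
  measurable_fun setT g -> (forall x, 0 <= g x) ->
  q.+1`!%:R%:E * simplex_int f 0 q.+1 t (fun s => g (nth 0%R s 0)) =
  (q.+1`!%:R / q`!%:R)%:E *
  \int[mu]_(y in `[0%R, t]) (g y * (f y * (1 - F y) ^+ q)%:E).
Proof.
move=> mg g0; apply: simplex_int_coef => //.
  exact: (measurableT_comp mg (@measurable_nth q.+1 0)).
rewrite (@simplex_int_gap_weighted 0%R 0%N q t _ _ (fun _ z => g z * q`!%:R%:E)); last 5 first.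
- by [].
- by rewrite addn1.
- by [].
- by move=> _ x; rewrite mule_ge0// lee_fin.
- by apply: emeasurable_funM => //; exact: (measurableT_comp mg measurable_snd).
apply: eq_integral => z _ /=; rewrite -muleA -EFinM Ft; congr (_ * _%:E).
by field.
Qed.

Lemma mean_two_order_statistics p q (g : R * R -> \bar R) (n := (q + p.+2)%N) :
  measurable_fun setT g -> (forall x, 0 <= g x) ->
  n`!%:R%:E * simplex_int f 0 n t (fun s => g (nth 0%R s p, nth 0%R s p.+1)) =
  (n`!%:R / (p`!%:R * q`!%:R))%:E *
  \int[mu]_(y in `[0%R, t]) \int[mu]_(x in `[0%R, y])
    (g (x, y) * (f x * f y * F x ^+ p * (1 - F y) ^+ q)%:E).
Proof.
move=> mg g0; apply: simplex_int_coef => //.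
  exact: (measurableT_comp mg (measurable_fun_pair (measurable_nth _) (measurable_nth _))).
pose C : R := (p`!%:R * q`!%:R)%R.
rewrite (@simplex_int_gap_weighted 0%R p.+1 q t _ _
  (fun s y => g (nth 0%R s p, y) * C%:E)); last 5 first.
- by [].
- by [].
- by move=> s; rewrite nth_take.
- by move=> s y; rewrite mule_ge0// lee_fin mulr_ge0.
- apply: emeasurable_funM => //; apply: (measurableT_comp mg).
  by apply: measurable_fun_pair => //; exact: measurable_nth_fst.
apply: eq_integral => y; rewrite inE /= in_itv/= => /andP[y0 yt].
set wy : R := (f y * _)%R.
have wy0 : (0 <= wy)%R.
  by rewrite !mulr_ge0// exprn_ge0// subr_ge0 (cdf_le nuF).
rewrite (@simplex_int_gap_weighted 0%R p 0 y _ _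
  (fun s x => g (x, y) * C%:E * wy%:E)); last 5 first.
- by [].
- by [].
- by [].
- by move=> s x; rewrite !mule_ge0// lee_fin mulr_ge0.
- apply: emeasurable_funM => //; apply: emeasurable_funM => //.
  by apply: (measurableT_comp mg); apply: measurable_fun_pair.
apply: eq_integral => x; rewrite inE /= in_itv/= => /andP[x0 xy].
rewrite (simplex_int_cst mf f0 nuf nuF _ x0); last first.
  by rewrite !mule_ge0// lee_fin ?mulr_ge0.
rewrite -!muleA -!EFinM; congr (_ * _%:E).
rewrite /wy /C F0 Ft subr0 expr0 fact0.
by field; rewrite !fact_neq0.
Qed.

Let weight_ge0 x y k : (x <= y)%R -> (0 <= f x * ((F y - F x) ^+ k / k`!%:R))%R.
Proof. by move=> xy; rewrite !mulr_ge0// exprn_ge0// subr_ge0 (cdf_le nuF). Qed.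

Lemma mean_first_and_two_order_statistics r q (g : R * R * R -> \bar R)
    (n := (q + r.+3)%N) :
  measurable_fun setT g -> (forall x, 0 <= g x) ->
  n`!%:R%:E * simplex_int f 0 n t
    (fun s => g (nth 0%R s 0, nth 0%R s r.+1, nth 0%R s r.+2)) =
  (n`!%:R / (r`!%:R * q`!%:R))%:E *
  \int[mu]_(z in `[0%R, t]) \int[mu]_(w in `[0%R, z]) \int[mu]_(y in `[0%R, w])
    (g (y, w, z) *
     (f y * f w * f z * (F w - F y) ^+ r * (1 - F z) ^+ q)%:E).
Proof.
move=> mg g0; apply: simplex_int_coef => //.
  apply: (measurableT_comp mg); apply: measurable_fun_pair; last exact: measurable_nth.
  by apply: measurable_fun_pair; exact: measurable_nth.
pose C : R := (r`!%:R * q`!%:R)%R.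
rewrite (@simplex_int_gap_weighted 0%R r.+2 q t _ _
  (fun s z => g (nth 0%R s 0, nth 0%R s r.+1, z) * C%:E)); last 5 first.
- by [].
- by [].
- by move=> s; rewrite !nth_take.
- by move=> s y; rewrite mule_ge0// lee_fin mulr_ge0.
- apply: emeasurable_funM => //; apply: (measurableT_comp mg).
  apply: measurable_fun_pair => //.
  by apply: measurable_fun_pair; exact: measurable_nth_fst.
apply: eq_integral => z; rewrite inE /= in_itv/= => /andP[z0 zt].
have wz0 := weight_ge0 q zt; set wz : R := (f z * _)%R in wz0 *.
rewrite (@simplex_int_gap_weighted 0%R r.+1 0 z _ _
  (fun s w => g (nth 0%R s 0, w, z) * C%:E * wz%:E)); last 5 first.
- by [].
- by [].
- by move=> s; rewrite !nth_take.
- by move=> s y; rewrite !mule_ge0// lee_fin mulr_ge0.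
- apply: emeasurable_funM => //; apply: emeasurable_funM => //.
  apply: (measurableT_comp mg); apply: measurable_fun_pair => //.
  by apply: measurable_fun_pair => //; exact: measurable_nth_fst.
apply: eq_integral => w; rewrite inE /= in_itv/= => /andP[w0 wz'].
have ww0 := weight_ge0 0 wz'; set ww : R := (f w * _)%R in ww0 *.
rewrite (@simplex_int_gap_weighted 0%R 0 r w _ _
  (fun s y => g (y, w, z) * C%:E * wz%:E * ww%:E)); last 5 first.
- by [].
- by rewrite addn1.
- by [].
- by move=> s y; rewrite !mule_ge0// lee_fin mulr_ge0.
- apply: emeasurable_funM => //; apply: emeasurable_funM => //.
  apply: emeasurable_funM => //; apply: (measurableT_comp mg).
  by apply: measurable_fun_pair => //; apply: measurable_fun_pair.
apply: eq_integral => y _; rewrite /simplex_int.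
rewrite -!muleA -!EFinM; congr (_ * _%:E).
rewrite /wz /ww /C Ft expr0 fact0.
by field; rewrite !fact_neq0.
Qed.

Lemma mean_three_order_statistics p q (g : R * R * R -> \bar R)
    (n := (q + p.+3)%N) :
  measurable_fun setT g -> (forall x, 0 <= g x) ->
  n`!%:R%:E * simplex_int f 0 n t
    (fun s => g (nth 0%R s p, nth 0%R s p.+1, nth 0%R s p.+2)) =
  (n`!%:R / (p`!%:R * q`!%:R))%:E *
  \int[mu]_(z in `[0%R, t]) \int[mu]_(w in `[0%R, z]) \int[mu]_(y in `[0%R, w])
    (g (y, w, z) * (f y * f w * f z * F y ^+ p * (1 - F z) ^+ q)%:E).
Proof.
move=> mg g0; apply: simplex_int_coef => //.
  apply: (measurableT_comp mg); apply: measurable_fun_pair; last exact: measurable_nth.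
  by apply: measurable_fun_pair; exact: measurable_nth.
pose C : R := (p`!%:R * q`!%:R)%R.
rewrite (@simplex_int_gap_weighted 0%R p.+2 q t _ _
  (fun s z => g (nth 0%R s p, nth 0%R s p.+1, z) * C%:E)); last 5 first.
- by [].
- by [].
- by move=> s; rewrite !nth_take.
- by move=> s y; rewrite mule_ge0// lee_fin mulr_ge0.
- apply: emeasurable_funM => //; apply: (measurableT_comp mg).
  apply: measurable_fun_pair => //.
  by apply: measurable_fun_pair; exact: measurable_nth_fst.
apply: eq_integral => z; rewrite inE /= in_itv/= => /andP[z0 zt].
have wz0 := weight_ge0 q zt; set wz : R := (f z * _)%R in wz0 *.
rewrite (@simplex_int_gap_weighted 0%R p.+1 0 z _ _
  (fun s w => g (nth 0%R s p, w, z) * C%:E * wz%:E)); last 5 first.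
- by [].
- by [].
- by move=> s; rewrite !nth_take.
- by move=> s y; rewrite !mule_ge0// lee_fin mulr_ge0.
- apply: emeasurable_funM => //; apply: emeasurable_funM => //.
  apply: (measurableT_comp mg); apply: measurable_fun_pair => //.
  by apply: measurable_fun_pair => //; exact: measurable_nth_fst.
apply: eq_integral => w; rewrite inE /= in_itv/= => /andP[w0 wz'].
have ww0 := weight_ge0 0 wz'; set ww : R := (f w * _)%R in ww0 *.
rewrite (@simplex_int_gap_weighted 0%R p 0 w _ _
  (fun s y => g (y, w, z) * C%:E * wz%:E * ww%:E)); last 5 first.
- by [].
- by [].
- by [].
- by move=> s y; rewrite !mule_ge0// lee_fin mulr_ge0.
- apply: emeasurable_funM => //; apply: emeasurable_funM => //.
  apply: emeasurable_funM => //; apply: (measurableT_comp mg).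
  by apply: measurable_fun_pair => //; apply: measurable_fun_pair.
apply: eq_integral => y; rewrite inE /= in_itv/= => /andP[y0 yw].
rewrite (simplex_int_cst mf f0 nuf nuF _ y0); last first.
  by rewrite !mule_ge0// lee_fin ?mulr_ge0// weight_ge0.
rewrite -!muleA -!EFinM; congr (_ * _%:E).
rewrite /wz /ww /C F0 Ft subr0 expr0 fact0.
by field; rewrite !fact_neq0.
Qed.

Lemma mean_four_order_statistics p r q (g : R * R * R * R -> \bar R)
    (n := (q + (p + r).+4)%N) :
  measurable_fun setT g -> (forall x, 0 <= g x) ->
  n`!%:R%:E * simplex_int f 0 n t
    (fun s => g (nth 0%R s p, nth 0%R s p.+1,
                 nth 0%R s (p + r).+2, nth 0%R s (p + r).+3)) =
  (n`!%:R / (p`!%:R * r`!%:R * q`!%:R))%:E *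
  \int[mu]_(z in `[0%R, t]) \int[mu]_(w in `[0%R, z]) \int[mu]_(y in `[0%R, w])
  \int[mu]_(x in `[0%R, y])
    (g (x, y, w, z) *
     (f x * f y * f w * f z * F x ^+ p * (F w - F y) ^+ r * (1 - F z) ^+ q)%:E).
Proof.
move=> mg g0; apply: simplex_int_coef => //.
  apply: (measurableT_comp mg); apply: measurable_fun_pair; last exact: measurable_nth.
  apply: measurable_fun_pair; last exact: measurable_nth.
  by apply: measurable_fun_pair; exact: measurable_nth.
pose C : R := (p`!%:R * r`!%:R * q`!%:R)%R.
have C0 : (0 <= C)%R by rewrite !mulr_ge0.
have pr1 : (p.+1 < (p + r).+2)%N by rewrite !ltnS leq_addr.
have pr0 : (p < (p + r).+2)%N by exact: ltnW.
rewrite (@simplex_int_gap_weighted 0%R (p + r).+3 q t _ _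
  (fun s z => g (nth 0%R s p, nth 0%R s p.+1, nth 0%R s (p + r).+2, z) * C%:E)); last 5 first.
- by [].
- by [].
- by move=> s; rewrite !nth_take// ltnW.
- by move=> s y; rewrite mule_ge0// lee_fin.
- apply: emeasurable_funM => //; apply: (measurableT_comp mg).
  apply: measurable_fun_pair => //.
  apply: measurable_fun_pair; last exact: measurable_nth_fst.
  by apply: measurable_fun_pair; exact: measurable_nth_fst.
apply: eq_integral => z; rewrite inE /= in_itv/= => /andP[z0 zt].
have wz0 := weight_ge0 q zt; set wz : R := (f z * _)%R in wz0 *.
rewrite (@simplex_int_gap_weighted 0%R (p + r).+2 0 z _ _
  (fun s w => g (nth 0%R s p, nth 0%R s p.+1, w, z) * C%:E * wz%:E)); last 5 first.
- by [].
- by [].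
- by move=> s; rewrite !nth_take.
- by move=> s y; rewrite !mule_ge0// lee_fin.
- apply: emeasurable_funM => //; apply: emeasurable_funM => //.
  apply: (measurableT_comp mg); apply: measurable_fun_pair => //.
  apply: measurable_fun_pair => //.
  by apply: measurable_fun_pair => //; exact: measurable_nth_fst.
apply: eq_integral => w; rewrite inE /= in_itv/= => /andP[w0 wz'].
have ww0 := weight_ge0 0 wz'; set ww : R := (f w * _)%R in ww0 *.
rewrite (@simplex_int_gap_weighted 0%R p.+1 r w _ _
  (fun s y => g (nth 0%R s p, y, w, z) * C%:E * wz%:E * ww%:E)); last 5 first.
- by [].
- by rewrite !addnS addnC.
- by move=> s; rewrite !nth_take.
- by move=> s y; rewrite !mule_ge0// lee_fin.
- apply: emeasurable_funM => //; apply: emeasurable_funM => //.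
  apply: emeasurable_funM => //; apply: (measurableT_comp mg).
  apply: measurable_fun_pair => //; apply: measurable_fun_pair => //.
  by apply: measurable_fun_pair => //; exact: measurable_nth_fst.
apply: eq_integral => y; rewrite inE /= in_itv/= => /andP[y0 yw].
have wy0 := weight_ge0 r yw; set wy : R := (f y * _)%R in wy0 *.
rewrite (@simplex_int_gap_weighted 0%R p 0 y _ _
  (fun s x => g (x, y, w, z) * C%:E * wz%:E * ww%:E * wy%:E)); last 5 first.
- by [].
- by [].
- by [].
- by move=> s x; rewrite !mule_ge0// lee_fin.
- apply: emeasurable_funM => //; apply: emeasurable_funM => //.
  apply: emeasurable_funM => //; apply: emeasurable_funM => //.
  apply: (measurableT_comp mg); apply: measurable_fun_pair => //.
  by apply: measurable_fun_pair => //; apply: measurable_fun_pair.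
apply: eq_integral => x; rewrite inE /= in_itv/= => /andP[x0 xy].
rewrite (simplex_int_cst mf f0 nuf nuF _ x0); last first.
  by rewrite !mule_ge0// lee_fin// weight_ge0.
rewrite -!muleA -!EFinM; congr (_ * _%:E).
rewrite /wz /ww /wy /C F0 Ft subr0 !expr0 fact0.
by field; rewrite !fact_neq0.
Qed.

End marked_order_statistics.

(** * The sigma-algebra of the counting process *)

Section same_integrals.
Context d (T : measurableType d) (R : realType).

(** On each set where one of the functions is bounded by an integer both are
    integrable, so that their integrals determine them almost everywhere; outside
    these countably many sets both are infinite. *)
Lemma ge0_ae_eq_of_integrals (m : {measure set T -> \bar R}) (u g : T -> \bar R) :
  m setT < +oo ->
  measurable_fun setT u -> measurable_fun setT g ->
  (forall x, 0 <= u x) -> (forall x, 0 <= g x) ->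
  (forall B, measurable B -> \int[m]_(x in B) u x = \int[m]_(x in B) g x) ->
  m.-negligible [set x | u x != g x].
Proof.
move=> moo; have key (v h : T -> \bar R) n : measurable_fun setT v -> measurable_fun setT h ->
    (forall x, 0 <= v x) -> (forall x, 0 <= h x) ->
    (forall B, measurable B -> \int[m]_(x in B) v x = \int[m]_(x in B) h x) ->
    m.-negligible [set x | v x <= n%:R%:E /\ v x != h x].
  move=> mv mh v0 h0 vh.
  pose A := [set x | v x <= n%:R%:E].
  have mA : measurable A.
    by rewrite -[X in measurable X]setTI; exact: measurable_lee.
  have : ae_eq m A v h.
    apply: integral_ae_eq => //.
    - apply: (@le_integrable _ _ _ _ _ mA _ (cst n%:R%:E)).
      + exact: measurable_funTS.
      + by move=> x Ax; rewrite /= gee0_abs// ger0_norm.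
      + apply/integrableP; split; first exact: measurable_cst.
        under eq_integral do rewrite /= ger0_norm//.
        rewrite integral_cst// lte_mul_pinfty//.
        by rewrite (le_lt_trans _ moo)// le_measure ?inE.
    - exact: measurable_funTS.
    - by move=> B _ mB; exact: vh.
  apply: negligibleS => x [Ax vhx] /(_ Ax) e.
  by rewrite e eqxx in vhx.
move=> mu mg u0 g0 ug.
have kug n := key u g n mu mg u0 g0 ug.
have kgu n := key g u n mg mu g0 u0 (fun B mB => esym (ug B mB)).
apply: (@negligibleS _ _ _ _ (\bigcup_n ([set x | u x <= n%:R%:E /\ u x != g x] `|`
    [set x | g x <= n%:R%:E /\ g x != u x]))); last first.
  by apply: negligible_bigcup => n; apply: negligibleU.
move=> x /= ux.
have bnd (y : \bar R) : 0 <= y -> y != +oo -> exists n, y <= n%:R%:E.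
  case: y => [r|//|//]; rewrite lee_fin => r0 _; exists (Num.bound r).
  by rewrite lee_fin ltW// archi_boundP.
have [uoo|/(bnd _ (u0 x))[n un]] := eqVneq (u x) +oo; last first.
  by exists n => //; left.
have [goo|/(bnd _ (g0 x))[n gn]] := eqVneq (g x) +oo.
  by rewrite uoo goo eqxx in ux.
by exists n => //; right; split=> //; rewrite eq_sym.
Qed.

End same_integrals.

Section counting_process.
Context d (Omega : measurableType d) (R : realType) (P : probability Omega R).
Variables (tau : nat -> {mfun Omega >-> \bar R}) (N : R -> Omega -> nat).
Hypothesis HN : claim_arrivals tau N.

Lemma arrivalS_ge i w : tau i w <= tau i.+1 w.
Proof.
have [oo|] := eqVneq (tau i w) +oo; first by rewrite (arrival_oo HN oo) oo.
by rewrite -ltey => /(arrival_lt HN)/ltW.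
Qed.

Lemma arrival_le i j w : (i <= j)%N -> tau i w <= tau j w.
Proof.
move=> /subnK <-; elim: (j - i)%N => [//|k IH].
exact: (le_trans IH (arrivalS_ge _ _)).
Qed.

Lemma arrival_ge0 i w : 0 <= tau i w.
Proof. by rewrite -(arrival0 HN w) arrival_le. Qed.

Lemma arrival_leE i s w : (0 <= s)%R -> (tau i w <= s%:E) = (i <= N s w)%N.
Proof.
move=> s0; apply/idP/idP; first exact: (count_max HN).
by move=> /(arrival_le w) /le_trans; apply; exact: (count_le HN).
Qed.

Lemma count_eqE n s : (0 <= s)%R ->
  [set w | N s w = n] = [set w | tau n w <= s%:E] `\` [set w | tau n.+1 w <= s%:E].
Proof.
move=> s0; apply/seteqP; split=> w; rewrite /= !arrival_leE//.
  by move=> ->; split=> //; rewrite ltnn.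
by move=> [nN /negP]; rewrite -leqNgt => Nn; apply/eqP; rewrite eqn_leq Nn.
Qed.

Lemma measurable_count n s : (0 <= s)%R -> measurable [set w | N s w = n].
Proof.
move=> s0; rewrite count_eqE//.
by apply: measurableD; rewrite -[X in measurable X]setTI; exact: measurable_lee.
Qed.

Definition counting_events : set (set Omega) :=
  [set E | exists (s : R) (n : nat), (0 <= s)%R /\ E = [set w | N s w = n]].

Local Notation OmegaN := (g_sigma_algebraType counting_events).

Lemma counting_measurable E : counting_sigma_algebra N E -> measurable E.
Proof.
apply: smallest_sub; first exact: sigma_algebra_measurable.
by move=> _ [s [n [s0 ->]]]; exact: measurable_count.
Qed.

(** The i-th claim arrives after time x when fewer than i claims have arrived by
    time x. *)
Lemma arrival_counting i : measurable_fun [set: OmegaN] (tau i : OmegaN -> \bar R).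
Proof.
apply: (measurability (@ErealGenOInfty.G R)) => [|_ [_ [x ->] <-]].
  exact: ErealGenOInfty.measurableE.
rewrite setTI.
have [x0|x0] := leP 0%R x; last first.
  rewrite (_ : _ @^-1` _ = setT); first exact: measurableT.
  apply/seteqP; split=> // w _; rewrite /= in_itv/= andbT.
  by rewrite (lt_le_trans _ (arrival_ge0 i w))// lte_fin.
rewrite (_ : _ @^-1` _ = \bigcup_(n in [set n | (n < i)%N]) [set w | N x w = n]).
  apply: bigcup_measurable => n _; apply: sub_sigma_algebra.
  by exists x, n.
apply/seteqP; split=> w /=; rewrite in_itv/= andbT.
  by rewrite ltNge arrival_leE// -ltnNge => Ni; exists (N x w).
by move=> [n ni Nn]; rewrite ltNge arrival_leE// -ltnNge Nn.
Qed.

Lemma arrival_time_counting i :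
  measurable_fun [set: OmegaN] (arrival_time tau i : OmegaN -> R).
Proof. exact: (measurableT_comp (@fine_measurable R setT measurableT)(arrival_counting i)). Qed.

Lemma arrived_counting i : counting_sigma_algebra N (arrived tau i).
Proof.
rewrite (_ : arrived tau i = (tau i : OmegaN -> \bar R) @^-1` [set~ +oo]).
  have := arrival_counting i measurableT (measurableC (emeasurable_set1 +oo)).
  by rewrite setTI.
by apply/seteqP; split=> w; rewrite /arrived /= ltey => /eqP.
Qed.

Lemma count_counting n s : (0 <= s)%R -> counting_sigma_algebra N [set w | N s w = n].
Proof. by move=> s0; apply: sub_sigma_algebra; exists s, n. Qed.

Lemma count_arrived n i s : (0 <= s)%R -> (i <= n)%N ->
  [set w | N s w = n] `<=` arrived tau i.
Proof.
move=> s0 iN w Nw; rewrite /arrived /=.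
by rewrite (@le_lt_trans _ _ s%:E) ?ltry// arrival_leE// Nw.
Qed.

Lemma counting_measurable_fun d' (T' : measurableType d') (V : Omega -> T') :
  measurable_fun [set: OmegaN] (V : OmegaN -> T') -> measurable_fun [set: Omega] V.
Proof.
move=> mV _ B mB; rewrite setTI.
by apply: counting_measurable; have := mV measurableT B mB; rewrite setTI.
Qed.

End counting_process.

(** * Replacing a claim by its regression function *)

Section regression.
Context d (Omega : measurableType d) (R : realType) (P : probability Omega R).
Variables (tau : nat -> {mfun Omega >-> \bar R}) (N : R -> Omega -> nat).
Hypothesis HN : claim_arrivals tau N.
Local Notation OmegaN := (g_sigma_algebraType (counting_events N)).

(** Let u(v) be the mean of G under the conditional law of Y, as a function of V'.
    For every event A of the process contained in D, Z and u(V') have the same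
    integral over A. The events D `&` V' @^-1` B identify u with g almost everywhere
    for the law of V' on D, and then A := E gives the claim. *)
Lemma integral_regression d1 d2 (T1 : measurableType d1) (T2 : measurableType d2)
    (D E : set Omega) (V : Omega -> T1) (V' : Omega -> T2) (phi : T2 -> T1)
    (Y Z : Omega -> R) (G : R -> R) (g : T2 -> \bar R) :
  counting_sigma_algebra N D -> counting_sigma_algebra N E -> E `<=` D ->
  measurable_fun [set: OmegaN] (V' : OmegaN -> T2) ->
  measurable_fun [set: T2] phi -> (forall w, V w = phi (V' w)) ->
  measurable_fun [set: Omega] Y -> measurable_fun [set: R] G ->
  (forall x, (0 <= G x)%R) -> (forall w, Z w = G (Y w)) ->
  cond_distribution_via P N D V Y -> regression_function P D V' Z g ->
  \int[P]_(w in E) (Z w)%:E = \int[P]_(w in E) g (V' w).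
Proof.
move=> GD GE ED mV'N mphi VE mY mG G0 ZE [kappa kappaE] [mg g0 gE].
have mD := counting_measurable HN GD.
have mE := counting_measurable HN GE.
have mV' := counting_measurable_fun HN mV'N.
pose u v := \int[kappa (phi v)]_y (G y)%:E.
have mu_ : measurable_fun setT u.
  have mk U : measurable U -> measurable_fun [set: T2] (fun v => kappa (phi v) U).
    by move=> mU; exact: (measurableT_comp (measurable_kernel kappa U mU) mphi).
  apply: (@measurable_fun_integral_kernel _ _ _ _ _ (kappa \o phi)) => //.
  exact/measurable_EFinP.
have u0 v : 0 <= u v by apply: integral_ge0 => y _; rewrite lee_fin.
have ZuE A : counting_sigma_algebra N A -> A `<=` D ->
    \int[P]_(w in A) (Z w)%:E = \int[P]_(w in A) u (V' w).
  move=> GA AD.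
  have mA := counting_measurable HN GA.
  transitivity (\int[P]_(w in A) (G (Y w))%:E).
    by apply: eq_integral => w _; rewrite ZE.
  rewrite (@ge0_integral_image_eq _ _ _ _ _ (measurableTypeR R) _ P A Y P A
    (fun w => kappa (V w)) (EFin \o G)) => //.
  - by apply: eq_integral => w _; rewrite VE.
  - move=> U mU; have mk := measurable_kernel kappa U mU.
    rewrite (_ : (fun _ => _) = (kappa ^~ U) \o (phi \o V')).
      apply: (measurableT_comp mk); exact: measurableT_comp.
    by apply/funext => w; rewrite /= VE.
  - by move=> U mU; exact: kappaE.
  - exact/measurable_EFinP.
rewrite ZuE//.
have [m mP] : exists m : {measure set T2 -> \bar R},
    forall B, m B = P (V' @^-1` B `&` D) := ex_image_measure (mrestr P mD) mV'.
have mB_int (h : T2 -> \bar R) B : measurable B -> measurable_fun setT h ->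
    (forall v, 0 <= h v) ->
    \int[m]_(v in B) h v = \int[P]_(w in D `&` V' @^-1` B) h (V' w).
  move=> mB mh h0; rewrite integral_mkcond integral_mkcondr.
  rewrite -[RHS]/(\int[P]_(w in D) (h \_ B) (V' w)).
  have mhB : measurable_fun setT (h \_ B).
    by apply/(measurable_restrictT _ _).1 => //; exact: measurable_funTS.
  have hB0 v : 0 <= (h \_ B) v by rewrite patchE; case: ifP.
  transitivity (\int[m]_v \int[\d_v]_x (h \_ B) x).
    by apply: eq_integral => v _; rewrite integral_dirac// diracT mul1e.
  apply/esym/ge0_integral_image_eq => //.
    by move=> U mU; apply/measurable_EFinP; exact: measurable_indic.
  move=> U mU; rewrite [RHS](eq_integral (fun v => (\1_U v)%:E)) //; last first.
  by rewrite integral_indic// setIT mP setIC.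
have : m.-negligible [set v | u v != g v].
  apply: ge0_ae_eq_of_integrals => //.
    by rewrite mP preimage_setT setTI (le_lt_trans (probability_le1 _ _))// ltry.
  move=> B mB; rewrite !mB_int//.
  have GDB : counting_sigma_algebra N (D `&` V' @^-1` B).
    have := mV'N measurableT B mB; rewrite setTI => GB.
    exact: (@measurableI _ OmegaN).
  by rewrite -(ZuE _ GDB (@subIsetl _ _ _)); exact: gE.
move=> [S [mS mS0 uS]].
apply: ge0_ae_eq_integral => //.
- exact/measurable_funTS/(measurableT_comp mu_ mV').
- exact/measurable_funTS/(measurableT_comp mg mV').
exists (V' @^-1` S `&` D); split.
- apply: measurableI => //; rewrite -[X in measurable X]setTI.
  exact: mV'.
- exact: (etrans (esym (mP S)) mS0).
- move=> w /= /not_implyP[Ew uw]; split; last exact: ED.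
  by apply: uS; apply/eqP.
Qed.

End regression.

(** * Samples from a distribution function with a density *)

Section law_from_cdf.
Context (R : realType).
Local Notation T := (measurableTypeR R).
Local Notation mu := (@lebesgue_measure R).

Lemma eq_cdf_measure (m1 m2 : {measure set T -> \bar R}) :
  (forall x : R, m1 [set` `]-oo, x]] < +oo) ->
  (forall x : R, m1 [set` `]-oo, x]] = m2 [set` `]-oo, x]]) ->
  forall A, measurable A -> m1 A = m2 A.
Proof.
move=> m1oo m12.
pose G := [set A : set T | exists x : R, A = [set` `]-oo, x]]].
apply: (measure_unique G (fun n => [set` `]-oo, n%:R]])) => //.
- transitivity (<<s (@RGenOInfty.G R) >>); first exact: RGenOInfty.measurableE.
  apply/seteqP; split; (apply: smallest_sub; first exact: smallest_sigma_algebra).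
    move=> _ [x ->]; rewrite -[X in <<s G >> X]setCK -setTD.
    by apply: sigma_algebraCD; apply: sub_sigma_algebra; exists x; rewrite setCitvr.
  move=> _ [x ->]; rewrite -[X in <<s _ >> X]setCK -setTD.
  by apply: sigma_algebraCD; apply: sub_sigma_algebra; exists x; rewrite setCitvl.
- move=> _ _ [x ->] [y ->]; exists (Num.min x y).
  by apply/seteqP; split=> z; rewrite /= !in_itv/= le_min => /andP.
- by move=> n; exists n%:R.
- apply/seteqP; split=> // x _; exists (Num.bound `|x|%R) => //=.
  by rewrite in_itv/= (le_trans (ler_norm x))// ltW// archi_boundP.
- by move=> _ [x ->].
Qed.

Variables (F : cumulativeBounded (0 : R)%R (1 : R)%R) (f : R -> R).

Definition law_of_cdf : probability T R := lebesgue_stieltjes_measure F.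

Lemma law_of_cdfE x : law_of_cdf [set` `]-oo, x]] = (F x)%:E.
Proof.
have := cdf_lebesgue_stieltjes_id F x.
by rewrite /cdf /distribution /pushforward preimage_id.
Qed.

Lemma law_of_cdf_density : has_density F f ->
  forall U : set T, measurable U -> law_of_cdf U = \int[mu]_(x in U) (f x)%:E.
Proof.
move=> [mf f0 Ff].
pose m U := \int[mu]_(x in U) (f x)%:E.
have [M ME] : exists M : {measure set T -> \bar R}, forall U, M U = m U.
  have m0 : m set0 = 0 by rewrite /m integral_set0.
  have mge0 U : 0 <= m U by apply: integral_ge0 => x _; rewrite lee_fin.
  have madd : semi_sigma_additive m.
    apply: semi_sigma_additive_nng_induced; first exact/measurable_EFinP.
    by move=> x; rewrite lee_fin.
  by exists (HB.pack_for {measure set T -> \bar R} m (isMeasure.Build _ _ _ m m0 mge0 madd)).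
move=> U mU; rewrite -[RHS]/(m U) -ME; apply: eq_cdf_measure => //.
  by move=> x; rewrite ltey_eq fin_num_measure.
by move=> x; rewrite ME /m -Ff; exact: law_of_cdfE.
Qed.

Variable t : R.
Hypotheses (t0 : (0 < t)%R) (Fneg : forall x, (x < 0)%R -> F x = 0%R) (Ft : F t = 1%R).
Hypothesis Hf : has_density F f.

Let mf : measurable_fun [set: R] f. Proof. by case: Hf. Qed.
Let f0 x : (0 <= f x)%R. Proof. by case: Hf. Qed.
Let nuf := law_of_cdf_density Hf.

(** F vanishes on the negative numbers, and 0 is not an atom. *)
Lemma cdf_at0 : F 0%R = 0%R.
Proof.
apply: EFin_inj; rewrite -law_of_cdfE.
rewrite (_ : [set` _] = [set 0%R] `|` \bigcup_n [set` `]-oo, (- n.+1%:R^-1)%R]]).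
  apply: measure_negligible.
    by apply: measurableU => //; exact: bigcup_measurable.
  apply: negligibleU; first by apply/negligibleP => //; exact: (density_atomless mf nuf).
  apply: negligible_bigcup => n; apply/negligibleP => //.
  by rewrite -[RHS](congr1 EFin (Fneg (x := (- n.+1%:R^-1)%R) _)) ?oppr_lt0 ?invr_gt0//; exact: law_of_cdfE.
apply/seteqP; split=> x; rewrite /= in_itv/=.
  rewrite le_eqVlt => /orP[/eqP ->|x0]; first by left.
  have /ltr_add_invr[n nx] : (0 < - x)%R by rewrite oppr_gt0.
  by right; exists n => //=; rewrite in_itv/= lerNr ltW// -[ltLHS]add0r.
move=> [->//|[n _]]; rewrite /= in_itv/= => /le_trans; apply.
by rewrite oppr_le0 invr_ge0.
Qed.

(** Almost all samples lie in [0, t], which adds the bounds 0 and t to the condition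
    that the sample is sorted. *)
Lemma ge0_integral_iid_law_order_statistics n (G : seq R -> \bar R) :
  (forall s, 0 <= G s) -> measurable_fun setT (fun s : n.-tuple T => G s) ->
  \int[iid_law law_of_cdf n]_s G (sort_tup s) =
  n`!%:R%:E * simplex_int f 0 n t G.
Proof.
move=> G0 mG; have t0' := ltW t0.
have nut : law_of_cdf [set` `[0%R, t]] = 1.
  by rewrite (law_itvcc mf nuf (law_of_cdfE))// cdf_at0 Ft subr0.
pose I (s : n.-tuple T) := (all (fun x => (0 <= x <= t)%R) (s : seq R)).
pose B : set (n.-tuple T) := box (fun=> [set` `[0%R, t]]).
have mB : measurable B := measurable_box (fun=> measurable_itv _).
have BI s : B s = I s :> Prop.
  apply/propext; split=> [sB|/allP sI k].
    by apply/allP => x /tnthP[k ->]; have := sB k; rewrite /= in_itv.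
  by rewrite /= in_itv/=; apply: sI; exact: mem_tnth.
have nuB : iid_law law_of_cdf n (~` B) = 0.
  rewrite probability_setC// (iid_law_box law_of_cdf (fun=> measurable_itv _)).
  by rewrite big1 ?subee// => k _; exact: nut.
have mI : measurable_fun setT (fun s => (I s)%:R%:E : \bar R).
  rewrite (_ : (fun _ => _) = fun s => (\1_B s)%:E); first exact/measurable_EFinP/measurable_indic.
  apply/funext => s; rewrite indicE (_ : (s \in B) = I s)//.
  by apply/idP/idP => [/set_mem|sI]; [rewrite BI|apply/mem_set; rewrite BI].
have mGI : measurable_fun setT (fun s : n.-tuple T => G s * (I s)%:R%:E).
  exact: emeasurable_funM.
have GI0 (s : n.-tuple T) : 0 <= G s * (I s)%:R%:E by rewrite mule_ge0// lee_fin.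
rewrite -(ge0_integral_iid_law_chain mf f0 nuf t0' G0 mG).
transitivity (\int[iid_law law_of_cdf n]_s (G (sort_tup s) * (I (sort_tup s))%:R%:E)).
  apply: ge0_ae_eq_integral => //.
  - exact: (measurableT_comp mG (@measurable_sort_tup R n)).
  - exact: (measurableT_comp mGI (@measurable_sort_tup R n)).
  - exists (~` B); split; [exact: measurableC|exact: nuB|].
    move=> s /=; apply: contra_not => sB _.
    rewrite /I /= all_sort -/(I s).
    by move: sB; rewrite BI => ->; rewrite mule1.
rewrite (ge0_integral_iid_law_sort (density_atomless mf nuf) mGI GI0).
congr (_ * _); apply: eq_integral => s _.
by rewrite path_rcons_sortedE// -muleA -EFinM -natrM mulnb andbC.
Qed.

End law_from_cdf.

(** * Arrival times given the number of claims *)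

Section order_statistic_process.
Context d (Omega : measurableType d) (R : realType) (P : probability Omega R).
Variables (tau : nat -> {mfun Omega >-> \bar R}) (N : R -> Omega -> nat).
Variable F : R -> cumulativeBounded (0 : R)%R (1 : R)%R.
Hypothesis HN : claim_arrivals tau N.
Hypothesis HOS : OS_point_process P tau N F.
Variables (t : R) (f : R -> R).
Hypotheses (t0 : (0 < t)%R) (Hf : has_density (F t) f).
Local Notation T := (measurableTypeR R).

(** Both laws give the same probability to every box. *)
Lemma mutually_independent_law d' (Omega' : measurableType d') (Q : probability Omega' R)
    n (U : 'I_n -> {RV Q >-> R}) :
  mutually_independent U -> (forall k x, cdf (U k) x = (F t x)%:E) ->
  forall A : set (n.-tuple T), measurable A ->
  Q [set w | A [tuple U k w | k < n]] = iid_law (law_of_cdf (F t)) n A.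
Proof.
move=> indU cdfU A mA.
pose V w : n.-tuple T := [tuple U k w | k < n].
have mU k : measurable_fun setT (U k : Omega' -> T) by exact: (@measurable_funPT _ _ _ _ (U k)).
have mV : measurable_fun setT V.
  apply/measurable_fun_tnthP => i; rewrite (_ : _ \o _ = U i); first exact: mU.
  by apply/funext => w; rewrite /V /= tnth_mktuple.
have [m mE] := ex_image_measure Q mV.
rewrite -[LHS]/(Q (V @^-1` A)) -mE; apply: tuple_measure_unique mA.
  by rewrite mE preimage_setT (le_lt_trans (probability_le1 Q measurableT))// ltry.
move=> B mB; rewrite mE [RHS]iid_law_box//.
transitivity (Q [set w | forall k, B k (U k w)]).
  by congr (Q _); apply/seteqP; split=> w wB k; have := wB k; rewrite /V tnth_mktuple.
rewrite indU//; apply: eq_bigr => k _.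
have [mk mkE] := ex_image_measure Q (mU k).
rewrite -mkE; apply: eq_cdf_measure => // x.
  by rewrite mkE (le_lt_trans (probability_le1 _ _)) ?ltry// -[X in measurable X]setTI; exact: mU.
by rewrite mkE [RHS]law_of_cdfE -(cdfU k).
Qed.

(** Given N t = n the arrival times form a sorted sample; the factor P[N t = n] undoes
    the conditioning, and both sides vanish when it is 0. *)
Lemma integral_arrivals_count n (G : seq R -> \bar R) :
  (forall s, 0 <= G s) -> measurable_fun setT (fun s : n.-tuple T => G s) ->
  \int[P]_(w in [set w | N t w = n]) G [tuple arrival_time tau k.+1 w | k < n] =
  count_prob P N t n * (n`!%:R%:E * simplex_int f 0 n t G).
Proof.
move=> G0 mG; have [Fneg Ftt OS] := HOS.
pose E := [set w | N t w = n].
have mE : measurable E by exact: (measurable_count HN n (ltW t0)).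
pose A w : n.-tuple T := [tuple arrival_time tau k.+1 w | k < n].
have mA : measurable_fun setT A.
  apply/measurable_fun_tnthP => i; rewrite (_ : _ \o _ = arrival_time tau i.+1).
    exact: (counting_measurable_fun HN (arrival_time_counting HN i.+1)).
  by apply/funext => w; rewrite /A /= tnth_mktuple.
have mGA : measurable_fun setT (G \o A) by exact: (measurableT_comp mG mA).
rewrite -(ge0_integral_iid_law_order_statistics t0 _ (Ftt t t0) Hf)//; last first.
  by move=> x; exact: Fneg.
have [PE0|PE] := eqVneq (P E) 0.
  by rewrite /count_prob -/E PE0 mul0e null_set_integral//; exact: measurable_funTS.
have PE_gt0 : 0 < P E by rewrite lt0e PE measure_ge0.
have [d1 [Om [Q [U [indU cdfU QU]]]]] := OS t n t0 PE_gt0.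
pose iid := iid_law (law_of_cdf (F t)) n.
have p0 : (0 <= fine (P E))%R by exact: fine_ge0.
have PEfin : P E \is a fin_num by rewrite fin_num_measure.
have fPE : (fine (P E) != 0)%R by rewrite fine_eq0.
have PAE B : measurable B ->
    P (E `&` A @^-1` B) = P E * iid ((@sort_tup R n) @^-1` B).
  move=> mB.
  have := QU B mB; rewrite /cond_prob -/E setIC => QB.
  have mAB : measurable (E `&` A @^-1` B).
    by apply: measurableI => //; rewrite -[X in measurable X]setTI; exact: mA.
  have msB : measurable ((@sort_tup R n) @^-1` B).
    by rewrite -[X in measurable X]setTI; exact: measurable_sort_tup.
  have QiidB := mutually_independent_law indU cdfU msB.
  rewrite -QiidB.
  have -> : Q [set w | (@sort_tup R n @^-1` B) [tuple U k w | k < n]] =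
      (fine (P (E `&` A @^-1` B)) / fine (P E))%:E.
    rewrite QB fineK// QiidB.
    exact: fin_num_measure.
  rewrite -[in RHS](fineK PEfin) -EFinM mulrC divfK//.
  by rewrite fineK// fin_num_measure.
pose l : {measure set (n.-tuple T) -> \bar R} := mscale (NngNum p0) iid.
pose k (s : n.-tuple T) : {measure set (n.-tuple T) -> \bar R} := \d_(sort_tup s : n.-tuple T).
have kE V : (k ^~ V) = fun s => (\1_((@sort_tup R n) @^-1` V) s)%:E.
  by apply/funext => s; rewrite /k /= diracE indicE.
have msort V : measurable V -> measurable ((@sort_tup R n) @^-1` V).
  by move=> mV; rewrite -[X in measurable X]setTI; exact: measurable_sort_tup.
transitivity (\int[l]_s \int[k s]_x G x); last first.
  have mGs : measurable_fun setT (fun s : n.-tuple T => G (sort_tup s)).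
    exact: (measurableT_comp mG (@measurable_sort_tup R n)).
  rewrite /l ge0_integral_mscale//=.
  - rewrite fineK//; congr (_ * _); apply: eq_integral => s _.
    by rewrite integral_dirac// diracT mul1e.
  - apply: (eq_measurable_fun (fun s : n.-tuple T => G (sort_tup s))) => // s _.
    by rewrite integral_dirac// diracT mul1e.
  - by move=> s _; exact: integral_ge0.
apply: (@ge0_integral_image_eq _ _ _ _ _ (n.-tuple T) _ P E A l setT k (fun s => G s)) => //.
- by move=> V mV; rewrite kE; apply/measurable_EFinP/measurable_indic; exact: msort.
- move=> V mV; transitivity (P E * iid ((@sort_tup R n) @^-1` V)); first exact: PAE.
  rewrite -[in LHS](fineK PEfin).
  transitivity (\int[l]_s (\1_((@sort_tup R n) @^-1` V) s)%:E).
    by rewrite integral_indic ?setIT//; exact: msort.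
  by apply: eq_integral => s _; rewrite -[RHS]/((k ^~ V) s) kE.
Qed.

End order_statistic_process.

(** * The coefficients as means over order statistics *)

Lemma sqr_sum_nat (R : comNzRingType) (x : nat -> R) m :
  ((\sum_(1 <= i < m) x i) ^+ 2 = \sum_(1 <= i < m) x i ^+ 2 +
   2%:R * \sum_(1 <= i < m) \sum_(i.+1 <= j < m) x i * x j)%R.
Proof.
elim: m => [|[|m] IH]; first by rewrite !big_geq// expr0n mulr0 addr0.
  by rewrite !big_geq// expr0n mulr0 addr0.
rewrite [X in (X ^+ 2)%R]big_nat_recr//= sqrrD IH.
rewrite [in RHS]big_nat_recr//= [X in _ = (_ + 2%:R * X)%R]big_nat_recr//=.
rewrite (@big_geq _ _ _ m.+2 m.+2)// addr0.
have -> : (\sum_(1 <= i < m.+1) \sum_(i.+1 <= j < m.+2) x i * x j =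
  \sum_(1 <= i < m.+1) \sum_(i.+1 <= j < m.+1) x i * x j +
  (\sum_(1 <= i < m.+1) x i) * x m.+1)%R.
  rewrite big_distrl -big_split/=; apply: eq_big_nat => i /andP[i1 im].
  by rewrite big_nat_recr.
ring.
Qed.

(** Pairs i < j are sorted by whether i = 1, when T_{i-1} = 0 is constant, and by
    whether j = i + 1, when T_i = T_{j-1}. *)
Lemma sum_pairs_split (R : nmodType) (a : nat -> nat -> R) n :
  (\sum_(1 <= i < n.+2) \sum_(i.+1 <= j < n.+2) a i j =
   (if (0 < n)%N then a 1%N 2%N else 0) + \sum_(3 <= j < n.+2) a 1%N j
     + \sum_(2 <= i < n.+1) a i i.+1
     + \sum_(2 <= i < n) \sum_(i.+2 <= j < n.+2) a i j)%R.
Proof.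
rewrite big_ltn//; case: n => [|n]; first by rewrite !big_geq// !addr0.
rewrite [X in (X + _)%R]big_ltn//= -!addrA; congr (_ + (_ + _))%R.
rewrite big_nat_recr//= [X in (_ + X)%R]big_geq// addr0.
rewrite (eq_big_nat _ _ (F2 := fun i => (a i i.+1 + \sum_(i.+2 <= j < n.+3) a i j)%R)).
  rewrite big_split/=; congr (_ + _)%R.
  case: n => [|n]; first by rewrite !big_geq.
  by rewrite big_nat_recr//= [X in (_ + X)%R]big_geq// addr0.
by move=> i /andP[_ ni]; rewrite big_ltn.
Qed.

Section coefficients.
Context (R : realType).
Variables (F : cumulativeBounded (0 : R)%R (1 : R)%R) (f : R -> R) (t : R).
Hypotheses (t0 : (0 < t)%R) (Fneg : forall x, (x < 0)%R -> F x = 0%R) (Ft : F t = 1%R).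
Hypothesis Hf : has_density F f.

Let mf : measurable_fun [set: R] f. Proof. by case: Hf. Qed.
Let f0 x : (0 <= f x)%R. Proof. by case: Hf. Qed.
Let nuf := law_of_cdf_density Hf.
Let F0 := cdf_at0 Fneg Hf.

Definition order_statistic_mean n (G : seq R -> \bar R) : \bar R :=
  n`!%:R%:E * simplex_int f 0 n t G.

Lemma order_statistic_mean_ge0 n G : (forall s, 0 <= G s) -> 0 <= order_statistic_mean n G.
Proof. by move=> G0; rewrite mule_ge0 ?lee_fin// simplex_int_ge0. Qed.

Lemma A_coefE m1 m2 n : measurable_fun [set: R] m1 -> (forall v, 0 <= m1 v) ->
  (forall i, (2 <= i)%N -> measurable_fun [set: R * R] (m2 i)) ->
  (forall i, (2 <= i)%N -> forall v, 0 <= m2 i v) ->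
  A_coef F f t m1 m2 n.+1 =
  order_statistic_mean n.+1 (fun s => m1 (nth 0%R s 0)) +
  \sum_(2 <= i < n.+2) order_statistic_mean n.+1
     (fun s => m2 i (nth 0%R s (i - 2), nth 0%R s (i - 1))).
Proof.
move=> mm1 m10 mm2 m20; congr (_ + _).
  rewrite /order_statistic_mean (mean_one_order_statistic mf f0 nuf (law_of_cdfE F) (ltW t0) Ft)//.
  by congr (_%:E * _); rewrite factS natrM mulfK// pnatr_eq0 -lt0n fact_gt0.
apply: eq_big_nat => i /andP[i2 ni].
have [p ip] : exists p, i = p.+2 by exists (i - 2)%N; lia.
have [q nq] : exists q, n.+1 = (q + p.+2)%N by exists (n.+1 - i)%N; lia.
rewrite /order_statistic_mean nq.
have -> : (i - 1 = p.+1)%N by lia.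
have -> : (q + p.+2 - i = q)%N by lia.
have -> : (i - 2 = p)%N by lia.
by rewrite (mean_two_order_statistics mf f0 nuf (law_of_cdfE F) (ltW t0) F0 Ft _ _ (mm2 i i2) (m20 i i2)).
Qed.

Lemma B_coefE c12 c1 cS c n :
  measurable_fun [set: R * R] c12 -> (forall v, 0 <= c12 v) ->
  (forall j, (3 <= j)%N -> measurable_fun [set: R * R * R] (c1 j)) ->
  (forall j, (3 <= j)%N -> forall v, 0 <= c1 j v) ->
  (forall i, (2 <= i)%N -> measurable_fun [set: R * R * R] (cS i)) ->
  (forall i, (2 <= i)%N -> forall v, 0 <= cS i v) ->
  (forall i j, (2 <= i)%N -> (i.+2 <= j)%N -> measurable_fun [set: R * R * R * R] (c i j)) ->
  (forall i j, (2 <= i)%N -> (i.+2 <= j)%N -> forall v, 0 <= c i j v) ->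
  B_coef F f t c12 c1 cS c n.+1 =
  (if (0 < n)%N then order_statistic_mean n.+1 (fun s => c12 (nth 0%R s 0, nth 0%R s 1))
   else 0)
  + \sum_(3 <= j < n.+2) order_statistic_mean n.+1
      (fun s => c1 j (nth 0%R s 0, nth 0%R s (j - 2), nth 0%R s (j - 1)))
  + \sum_(2 <= i < n.+1) order_statistic_mean n.+1
      (fun s => cS i (nth 0%R s (i - 2), nth 0%R s (i - 1), nth 0%R s i))
  + \sum_(2 <= i < n) \sum_(i.+2 <= j < n.+2) order_statistic_mean n.+1
      (fun s => c i j (nth 0%R s (i - 2), nth 0%R s (i - 1),
                       nth 0%R s (j - 2), nth 0%R s (j - 1))).
Proof.
move=> mc12 c120 mc1 c10 mcS cS0 mc c0.
rewrite /B_coef; congr (_ + _ + _ + _).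
- case: ifPn => [n0|]; last by rewrite -eqn0Ngt => /eqP ->; rewrite muln0 mul0e.
  have [q nq] : exists q, n.+1 = (q + 2)%N by exists (n.-1)%N; lia.
  rewrite /order_statistic_mean nq.
  rewrite (mean_two_order_statistics mf f0 nuf (law_of_cdfE F) (ltW t0) F0 Ft 0 _ mc12 c120).
  have -> : (q + 2 - 2 = q)%N by lia.
  apply: (congr2 (fun (x : R) y => x%:E * y)).
    by rewrite fact0 mul1r addn2 !factS [in RHS]mulnA [in RHS]natrM mulfK// pnatr_eq0 -lt0n fact_gt0.
  apply: eq_integral => z _; apply: eq_integral => y _.
  by rewrite expr0 mulr1.
- apply: eq_big_nat => j /andP[j3 nj].
  have [r jr] : exists r, j = r.+3 by exists (j - 3)%N; lia.
  have [q nq] : exists q, n.+1 = (q + r.+3)%N by exists (n.+1 - j)%N; lia.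
  rewrite /order_statistic_mean nq.
  have -> : (j - 2 = r.+1)%N by lia.
  have -> : (j - 1 = r.+2)%N by lia.
  have -> : (q + r.+3 - j = q)%N by lia.
  have -> : (j - 3 = r)%N by lia.
  by rewrite (mean_first_and_two_order_statistics mf f0 nuf (law_of_cdfE F) (ltW t0) Ft _ _ (mc1 j j3) (c10 j j3)).
- apply: eq_big_nat => i /andP[i2 ni].
  have [p ip] : exists p, i = p.+2 by exists (i - 2)%N; lia.
  have [q nq] : exists q, n.+1 = (q + p.+3)%N by exists (n - i)%N; lia.
  subst i; rewrite /order_statistic_mean nq.
  have -> : (q + p.+3 - p.+2 - 1 = q)%N by lia.
  have -> : (p.+2 - 2 = p)%N by lia.
  have -> : (p.+2 - 1 = p.+1)%N by lia.
  by rewrite (mean_three_order_statistics mf f0 nuf (law_of_cdfE F) (ltW t0) F0 Ft _ _ (mcS _ i2) (cS0 _ i2)).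
- apply: eq_big_nat => i /andP[i2 ni]; apply: eq_big_nat => j /andP[ij nj].
  have [p ip] : exists p, i = p.+2 by exists (i - 2)%N; lia.
  have [r jr] : exists r, j = (p + r).+4 by exists (j - i - 2)%N; lia.
  have [q nq] : exists q, n.+1 = (q + (p + r).+4)%N by exists (n.+1 - j)%N; lia.
  rewrite /order_statistic_mean nq.
  have -> : (q + (p + r).+4 - j = q)%N by lia.
  have -> : (j - i - 2 = r)%N by lia.
  have -> : (i - 2 = p)%N by lia.
  have -> : (i - 1 = p.+1)%N by lia.
  have -> : (j - 2 = (p + r).+2)%N by lia.
  have -> : (j - 1 = (p + r).+3)%N by lia.
  by rewrite (mean_four_order_statistics mf f0 nuf (law_of_cdfE F) (ltW t0) F0 Ft _ _ _ (mc i j i2 ij) (c0 i j i2 ij)).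
Qed.

End coefficients.

(** * Moments of the claims given the number of claims *)

Section claims.
Context d (Omega : measurableType d) (R : realType) (P : probability Omega R).
Variables (tau : nat -> {mfun Omega >-> \bar R}) (N : R -> Omega -> nat).
Variable F : R -> cumulativeBounded (0 : R)%R (1 : R)%R.
Hypothesis HN : claim_arrivals tau N.
Hypothesis HOS : OS_point_process P tau N F.
Variables (t : R) (f : R -> R).
Hypotheses (t0 : (0 < t)%R) (Hf : has_density (F t) f).
Local Notation OmegaN := (g_sigma_algebraType (counting_events N)).
Local Notation T := (measurableTypeR R).
Local Notation mean n G := (order_statistic_mean f t n G).

(** V are the times on which the law of Y depends and V' the times kept in the
    regression; phi restores the redundant ones, and sel picks V' among the n
    arrival times. *)
Lemma integral_claims_count d1 d2 (T1 : measurableType d1) (T2 : measurableType d2)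
    n i (V : Omega -> T1) (V' : Omega -> T2) (phi : T2 -> T1) (sel : seq R -> T2)
    (Y Z : Omega -> R) (G : R -> R) (g : T2 -> \bar R) :
  (i <= n)%N ->
  measurable_fun [set: OmegaN] (V' : OmegaN -> T2) ->
  measurable_fun [set: T2] phi -> (forall w, V w = phi (V' w)) ->
  measurable_fun [set: n.-tuple T] (fun s => sel s) ->
  (forall w, V' w = sel [tuple arrival_time tau k.+1 w | k < n]) ->
  measurable_fun [set: Omega] Y -> measurable_fun [set: R] G ->
  (forall x, (0 <= G x)%R) -> (forall w, Z w = G (Y w)) ->
  cond_distribution_via P N (arrived tau i) V Y ->
  regression_function P (arrived tau i) V' Z g ->
  \int[P]_(w in [set w | N t w = n]) (Z w)%:E =
  count_prob P N t n * mean n (fun s => g (sel s)).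
Proof.
move=> ni mV' mphi VE msel selE mY mG G0 ZE HV Hg.
rewrite (integral_regression HN (arrived_counting HN i)
  (@count_counting _ _ _ N n _ (ltW t0)) (count_arrived HN (ltW t0) ni)
  mV' mphi VE mY mG G0 ZE HV Hg).
have [mg g0 _] := Hg.
rewrite /order_statistic_mean -(integral_arrivals_count HN HOS t0 Hf)//.
  by apply: eq_integral => w _; rewrite -selE.
exact: (measurableT_comp mg msel).
Qed.

Lemma nth_arrivals n k w : (k < n)%N ->
  nth 0%R [tuple arrival_time tau k.+1 w | k < n] k = arrival_time tau k.+1 w.
Proof.
move=> kn; rewrite -[k in nth _ _ k]/(nat_of_ord (Ordinal kn)) -tnth_nth tnth_mktuple.
by [].
Qed.

Let mtau i : measurable_fun [set: OmegaN] (arrival_time tau i : OmegaN -> R).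
Proof. exact: arrival_time_counting. Qed.

Let tau0 w : arrival_time tau 0%N w = 0%R.
Proof. by rewrite /arrival_time (arrival0 HN). Qed.

Variable X : nat -> {mfun Omega >-> R}.
Hypothesis HX : forall i w, (1 <= i)%N -> (0 <= X i w)%R.

Let mXX i j : measurable_fun [set: Omega] (fun w => X i w * X j w)%R.
Proof. exact: measurable_funM. Qed.

(** The map G of integral_claims_count is nonnegative on the whole line, so that a
    product of claims has to be read as its absolute value. *)
Let absXX i j w : (1 <= i)%N -> (1 <= j)%N -> (X i w * X j w = `|X i w * X j w|)%R.
Proof. by move=> i1 j1; rewrite ger0_norm// mulr_ge0// HX. Qed.

Local Notation count_is n := [set w | N t w = n].

Lemma integral_first_square n m1 : (1 <= n)%N ->
  cond_distribution_via P N (arrived tau 1)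
    (fun w => (arrival_time tau 0 w, arrival_time tau 1 w)) (X 1) ->
  regression_function P (arrived tau 1) (arrival_time tau 1%N)
    (fun w => X 1%N w ^+ 2)%R m1 ->
  \int[P]_(w in count_is n) (X 1%N w ^+ 2)%:E =
  count_prob P N t n * mean n (fun s => m1 (nth 0%R s 0)).
Proof.
move=> n1 HV Hg; apply: (integral_claims_count (phi := fun y : R => (0%R : R, y)) (G := (fun x : R => x ^+ 2)%R)
  (sel := fun s : seq R => nth 0%R s 0)
  n1 _ _ _ _ _ _ _ _ _ HV Hg) => //.
- exact: measurable_fun_pair.
- by move=> w; rewrite tau0.
- exact: measurable_nth.
- by move=> w; rewrite nth_arrivals.
- by move=> x; exact: sqr_ge0.
Qed.

Lemma integral_square n i m2 : (2 <= i <= n)%N ->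
  cond_distribution_via P N (arrived tau i)
    (fun w => (arrival_time tau i.-1 w, arrival_time tau i w)) (X i) ->
  regression_function P (arrived tau i)
    (fun w => (arrival_time tau i.-1 w, arrival_time tau i w))
    (fun w => X i w ^+ 2)%R m2 ->
  \int[P]_(w in count_is n) (X i w ^+ 2)%:E =
  count_prob P N t n * mean n (fun s => m2 (nth 0%R s (i - 2), nth 0%R s (i - 1))).
Proof.
move=> /andP[i2 ni] HV Hg; apply: (integral_claims_count (phi := id) (G := (fun x : R => x ^+ 2)%R)
  (sel := fun s : seq R => (nth 0%R s (i - 2), nth 0%R s (i - 1)))
  ni _ _ _ _ _ _ _ _ _ HV Hg) => //.
- exact: measurable_fun_pair.
- by apply: measurable_fun_pair; exact: measurable_nth.
- move=> w; rewrite !nth_arrivals; [|lia..].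
  have -> : ((i - 2).+1 = i.-1)%N by lia.
  have -> : ((i - 1).+1 = i)%N by lia.
  by [].
- by move=> x; exact: sqr_ge0.
Qed.

Lemma integral_first_two n c12 : (2 <= n)%N ->
  cond_distribution_via P N (arrived tau 2)
    (fun w => (arrival_time tau 0 w, arrival_time tau 1 w,
               arrival_time tau 1 w, arrival_time tau 2 w))
    (fun w => X 1 w * X 2 w)%R ->
  regression_function P (arrived tau 2%N)
    (fun w => (arrival_time tau 1%N w, arrival_time tau 2%N w))
    (fun w => X 1%N w * X 2%N w)%R c12 ->
  \int[P]_(w in count_is n) (X 1%N w * X 2%N w)%:E =
  count_prob P N t n * mean n (fun s => c12 (nth 0%R s 0, nth 0%R s 1)).
Proof.
move=> n2 HV Hg; apply: (integral_claims_count (phi := fun v : R * R => (0%R : R, v.1, v.1, v.2))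
  (G := (fun x : R => `|x|)%R) (sel := fun s : seq R => (nth 0%R s 0, nth 0%R s 1))
  n2 _ _ _ _ _ _ _ _ _ HV Hg) => //.
- exact: measurable_fun_pair.
- by do 3 (apply: measurable_fun_pair => //).
- by move=> w; rewrite tau0.
- by apply: measurable_fun_pair; exact: measurable_nth.
- by move=> w; rewrite !nth_arrivals//; exact: ltnW.
- by move=> w; exact: absXX.
Qed.

Lemma integral_first_and_far n j c1 : (3 <= j <= n)%N ->
  cond_distribution_via P N (arrived tau j)
    (fun w => (arrival_time tau 0 w, arrival_time tau 1 w,
               arrival_time tau j.-1 w, arrival_time tau j w))
    (fun w => X 1 w * X j w)%R ->
  regression_function P (arrived tau j)
    (fun w => (arrival_time tau 1%N w, arrival_time tau j.-1 w, arrival_time tau j w))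
    (fun w => X 1%N w * X j w)%R c1 ->
  \int[P]_(w in count_is n) (X 1%N w * X j w)%:E =
  count_prob P N t n *
  mean n (fun s => c1 (nth 0%R s 0, nth 0%R s (j - 2), nth 0%R s (j - 1))).
Proof.
move=> /andP[j3 nj] HV Hg; apply: (integral_claims_count
  (phi := fun v : R * R * R => (0%R : R, v.1.1, v.1.2, v.2)) (G := (fun x : R => `|x|)%R)
  (sel := fun s : seq R => (nth 0%R s 0, nth 0%R s (j - 2), nth 0%R s (j - 1)))
  nj _ _ _ _ _ _ _ _ _ HV Hg) => //.
- by do 2 (apply: measurable_fun_pair => //).
- have m1 : measurable_fun [set: R * R * R] (fun v => v.1.1).
    exact: (measurableT_comp measurable_fst measurable_fst).
  have m2 : measurable_fun [set: R * R * R] (fun v => v.1.2).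
    exact: (measurableT_comp measurable_snd measurable_fst).
  by do 3 (apply: measurable_fun_pair => //).
- by move=> w; rewrite tau0.
- by do 2 (apply: measurable_fun_pair; last exact: measurable_nth); exact: measurable_nth.
- move=> w; rewrite !nth_arrivals; [|lia..].
  have -> : ((j - 2).+1 = j.-1)%N by lia.
  have -> : ((j - 1).+1 = j)%N by lia.
  by [].
- by move=> w; apply: absXX; lia.
Qed.

Lemma integral_neighbours n i cS : (2 <= i < n)%N ->
  cond_distribution_via P N (arrived tau i.+1)
    (fun w => (arrival_time tau i.-1 w, arrival_time tau i w,
               arrival_time tau i w, arrival_time tau i.+1 w))
    (fun w => X i w * X i.+1 w)%R ->
  regression_function P (arrived tau i.+1)
    (fun w => (arrival_time tau i.-1 w, arrival_time tau i w, arrival_time tau i.+1 w))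
    (fun w => X i w * X i.+1 w)%R cS ->
  \int[P]_(w in count_is n) (X i w * X i.+1 w)%:E =
  count_prob P N t n *
  mean n (fun s => cS (nth 0%R s (i - 2), nth 0%R s (i - 1), nth 0%R s i)).
Proof.
move=> /andP[i2 ni] HV Hg; apply: (integral_claims_count
  (phi := fun v : R * R * R => (v.1.1, v.1.2, v.1.2, v.2)) (G := (fun x : R => `|x|)%R)
  (sel := fun s : seq R => (nth 0%R s (i - 2), nth 0%R s (i - 1), nth 0%R s i))
  ni _ _ _ _ _ _ _ _ _ HV Hg) => //.
- by do 2 (apply: measurable_fun_pair => //).
- have m1 : measurable_fun [set: R * R * R] (fun v => v.1.1).
    exact: (measurableT_comp measurable_fst measurable_fst).
  have m2 : measurable_fun [set: R * R * R] (fun v => v.1.2).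
    exact: (measurableT_comp measurable_snd measurable_fst).
  by do 3 (apply: measurable_fun_pair => //).
- by do 2 (apply: measurable_fun_pair; last exact: measurable_nth); exact: measurable_nth.
- move=> w; rewrite !nth_arrivals; [|lia..].
  have -> : ((i - 2).+1 = i.-1)%N by lia.
  have -> : ((i - 1).+1 = i)%N by lia.
  by [].
- by move=> w; apply: absXX; lia.
Qed.

Lemma integral_far n i j c : (2 <= i)%N -> (i.+2 <= j <= n)%N ->
  cond_distribution_via P N (arrived tau j)
    (fun w => (arrival_time tau i.-1 w, arrival_time tau i w,
               arrival_time tau j.-1 w, arrival_time tau j w))
    (fun w => X i w * X j w)%R ->
  regression_function P (arrived tau j)
    (fun w => (arrival_time tau i.-1 w, arrival_time tau i w,
               arrival_time tau j.-1 w, arrival_time tau j w))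
    (fun w => X i w * X j w)%R c ->
  \int[P]_(w in count_is n) (X i w * X j w)%:E =
  count_prob P N t n *
  mean n (fun s => c (nth 0%R s (i - 2), nth 0%R s (i - 1),
                      nth 0%R s (j - 2), nth 0%R s (j - 1))).
Proof.
move=> i2 /andP[ij nj] HV Hg; apply: (integral_claims_count (phi := id) (G := (fun x : R => `|x|)%R)
  (sel := fun s : seq R => (nth 0%R s (i - 2), nth 0%R s (i - 1),
                    nth 0%R s (j - 2), nth 0%R s (j - 1)))
  nj _ _ _ _ _ _ _ _ _ HV Hg) => //.
- by do 3 (apply: measurable_fun_pair => //).
- by do 3 (apply: measurable_fun_pair; last exact: measurable_nth); exact: measurable_nth.
- move=> w; rewrite !nth_arrivals; [|lia..].
  have -> : ((i - 2).+1 = i.-1)%N by lia.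
  have -> : ((i - 1).+1 = i)%N by lia.
  have -> : ((j - 2).+1 = j.-1)%N by lia.
  have -> : ((j - 1).+1 = j)%N by lia.
  by [].
- by move=> w; apply: absXX; lia.
Qed.

End claims.

(** * The second moment of the aggregate claim *)

Section real_integrals.
Context d (T : measurableType d) (R : realType) (mu : {measure set T -> \bar R}).
Variables (E : set T) (mE : measurable E).

Lemma ge0_integralD_EFin (a b : T -> R) :
  measurable_fun [set: T] a -> measurable_fun [set: T] b ->
  (forall x, (0 <= a x)%R) -> (forall x, (0 <= b x)%R) ->
  \int[mu]_(x in E) (a x + b x)%:E =
  \int[mu]_(x in E) (a x)%:E + \int[mu]_(x in E) (b x)%:E.
Proof.
move=> ma mb a0 b0; under eq_integral do rewrite EFinD.
by rewrite ge0_integralD//; do ?[by move=> x _; rewrite lee_fin];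
  exact/measurable_funTS/measurable_EFinP.
Qed.

Lemma ge0_integral_sum_nat (a : nat -> T -> R) m n :
  (forall i, measurable_fun [set: T] (a i)) ->
  (forall i x, (m <= i)%N -> (0 <= a i x)%R) ->
  \int[mu]_(x in E) (\sum_(m <= i < n) a i x)%:E =
  \sum_(m <= i < n) \int[mu]_(x in E) (a i x)%:E.
Proof.
move=> ma a0; have [nm|mn] := leqP n m.
  rewrite [RHS]big_geq// integral0_eq// => x _; rewrite big_geq//.
elim: n mn => [//|n IH]; rewrite ltnS leq_eqVlt => /orP[/eqP <-|mn].
  by rewrite big_nat1; apply: eq_integral => x _; rewrite big_nat1.
have mn' := ltnW mn.
rewrite [RHS]big_nat_recr//= -IH// -ge0_integralD_EFin//.
- by apply: eq_integral => x _; rewrite big_nat_recr.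
- exact: measurable_sum.
- by move=> x; rewrite big_nat; apply: sumr_ge0 => i /andP[/a0].
- by move=> x; exact: a0.
Qed.

Lemma ge0_integralZl_real (a : T -> R) (k : R) :
  measurable_fun [set: T] a -> (forall x, (0 <= a x)%R) -> (0 <= k)%R ->
  \int[mu]_(x in E) (k * a x)%:E = k%:E * \int[mu]_(x in E) (a x)%:E.
Proof.
move=> ma a0 k0; under eq_integral do rewrite EFinM.
by rewrite ge0_integralZl ?lee_fin//; [exact/measurable_funTS/measurable_EFinP
  |move=> x _; rewrite lee_fin].
Qed.

End real_integrals.

Lemma mule_sum_nat (R : realDomainType) (p : \bar R) (a : nat -> \bar R) m n :
  (forall i, (m <= i < n)%N -> 0 <= a i) ->
  p * (\sum_(m <= i < n) a i) = \sum_(m <= i < n) p * a i.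
Proof. by move=> a0; rewrite big_nat [RHS]big_nat ge0_sume_distrr. Qed.

Lemma sume_nat_ge0 (R : numDomainType) (a : nat -> \bar R) m n :
  (forall i, (m <= i < n)%N -> 0 <= a i) -> 0 <= \sum_(m <= i < n) a i.
Proof. by move=> a0; rewrite big_nat; exact: sume_ge0. Qed.

Lemma mule_squares_pairs (R : realDomainType) (p v1 v2 w1 w2 w3 w4 : \bar R) :
  0 <= v1 -> 0 <= v2 -> 0 <= w1 -> 0 <= w2 -> 0 <= w3 -> 0 <= w4 ->
  p * (v1 + v2 + 2%:R%:E * (w1 + w2 + w3 + w4)) =
  p * v1 + p * v2 + 2%:R%:E * (p * w1 + p * w2 + p * w3 + p * w4).
Proof.
move=> v10 v20 w10 w20 w30 w40.
have two0 : 0 <= 2%:R%:E :> \bar R by rewrite lee_fin.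
have w0 : 0 <= w1 + w2 + w3 + w4 by rewrite !adde_ge0.
rewrite ge0_muleDr; [|exact: adde_ge0|exact: mule_ge0].
rewrite muleCA ge0_muleDr//; congr (_ + _ * _).
by rewrite ge0_muleDr ?adde_ge0// ge0_muleDr ?adde_ge0// ge0_muleDr.
Qed.

Theorem theorem2p2 (d : measure_display) (Omega : measurableType d)
    (R : realType) (P : probability Omega R)
    (tau : nat -> {mfun Omega >-> \bar R}) (N : R -> Omega -> nat)
    (X : nat -> {mfun Omega >-> R})
    (F : R -> cumulativeBounded (0 : R)%R (1 : R)%R)
    (t : R) (f : R -> R)
    (m1 : R -> \bar R) (m2 : nat -> R * R -> \bar R)
    (c12 : R * R -> \bar R) (c1 cS : nat -> R * R * R -> \bar R)
    (c : nat -> nat -> R * R * R * R -> \bar R)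
    (HN : claim_arrivals tau N)
    (HX : forall i w, (1 <= i)%N -> (0 <= X i w)%R)
    (HOS : OS_point_process P tau N F)
    (ht : (0 < t)%R)
    (Hf : has_density (F t) f)
    (HdepX : forall i, (1 <= i)%N ->
       cond_distribution_via P N (arrived tau i)
         (fun w => (arrival_time tau i.-1 w, arrival_time tau i w))
         (X i))
    (HdepXX : forall i j, (1 <= i)%N -> (i < j)%N ->
       cond_distribution_via P N (arrived tau j)
         (fun w => (arrival_time tau i.-1 w, arrival_time tau i w,
                    arrival_time tau j.-1 w, arrival_time tau j w))
         (fun w => X i w * X j w)%R)
    (Hm1 : regression_function P (arrived tau 1%N)
       (arrival_time tau 1%N)
       (fun w => X 1%N w ^+ 2)%R m1)
    (Hm2 : forall i, (2 <= i)%N ->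
       regression_function P (arrived tau i)
         (fun w => (arrival_time tau i.-1 w, arrival_time tau i w))
         (fun w => X i w ^+ 2)%R (m2 i))
    (Hc12 : regression_function P (arrived tau 2%N)
       (fun w => (arrival_time tau 1%N w, arrival_time tau 2%N w))
       (fun w => X 1%N w * X 2%N w)%R c12)
    (Hc1 : forall j, (3 <= j)%N ->
       regression_function P (arrived tau j)
         (fun w => (arrival_time tau 1%N w,
                    arrival_time tau j.-1 w, arrival_time tau j w))
         (fun w => X 1%N w * X j w)%R (c1 j))
    (HcS : forall i, (2 <= i)%N ->
       regression_function P (arrived tau i.+1)
         (fun w => (arrival_time tau i.-1 w, arrival_time tau i w,
                    arrival_time tau i.+1 w))
         (fun w => X i w * X i.+1 w)%R (cS i))
    (Hc : forall i j, (2 <= i)%N -> (i.+2 <= j)%N ->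
       regression_function P (arrived tau j)
         (fun w => (arrival_time tau i.-1 w, arrival_time tau i w,
                    arrival_time tau j.-1 w, arrival_time tau j w))
         (fun w => X i w * X j w)%R (c i j)) :
  'E_P[(fun w => aggregate_claim X N t w ^+ 2)%R] =
  \sum_(1 <= n <oo)
    count_prob P N t n
    * (A_coef (F t) f t m1 m2 n + 2%:R%:E * B_coef (F t) f t c12 c1 cS c n).
Proof.
have [Fneg Ftt _] := HOS; have t0 := ltW ht.
pose S w := aggregate_claim X N t w.
pose E n := [set w | N t w = n].
have mE n : measurable (E n) by exact: (measurable_count HN n t0).
have UE : \bigcup_n E n = setT by apply/seteqP; split=> // w _; exists (N t w).
have tE : trivIset setT E by move=> i j _ _ [w [/= <- <-]].
have mXi i : measurable_fun setT (X i) by exact: measurable_funPT.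
have SE n w : E n w -> S w = (\sum_(1 <= i < n.+1) X i w)%R.
  by rewrite /S /aggregate_claim => ->.
have mS : measurable_fun setT S.
  rewrite -UE; apply/measurable_fun_bigcup => // n.
  apply: (eq_measurable_fun (fun w => \sum_(1 <= i < n.+1) X i w)%R).
    by move=> w; rewrite inE => /SE ->.
  exact/measurable_funTS/measurable_sum.
have mS2 : measurable_fun setT (fun w => (S w ^+ 2)%:E).
  exact/measurable_EFinP/measurable_funX.
rewrite unlock -UE ge0_integral_bigcup//; last 2 first.
- by rewrite UE.
- by move=> w _; rewrite lee_fin sqr_ge0.
(* The series of the statement starts at n = 1, and S = 0 on E 0. *)
rewrite nneseries_recl//; last first.
  by move=> n _; apply: integral_ge0 => w _; rewrite lee_fin sqr_ge0.
rewrite [X in X + _]integral0_eq ?add0e; last first.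
  by move=> w Ew; rewrite -/(S w) (SE _ _ Ew) big_geq// expr0n.
apply: congr_lim; apply/funext => K; apply: eq_big_nat => n /andP[n1 _].
case: n n1 => // n _.
rewrite -/(E _).
have X0 i w : (0 < i)%N -> (0 <= X i w)%R by move=> i0; exact: HX.
have mXX i j : measurable_fun setT (fun w => X i w * X j w)%R by exact: measurable_funM.
have XX0 i j w : (0 < i)%N -> (0 < j)%N -> (0 <= X i w * X j w)%R.
  by move=> i0 j0; rewrite mulr_ge0 ?X0.
have [mm1 m10 _] := Hm1; have [mc12 c120 _] := Hc12.
have Fn x : (x < 0)%R -> F t x = 0%R by exact: Fneg.
have mm2 i (i2 : (2 <= i)%N) : measurable_fun setT (m2 i) by case: (Hm2 i i2).
have m20 i (i2 : (2 <= i)%N) v : 0 <= m2 i v by case: (Hm2 i i2).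
have mc1 j (j3 : (3 <= j)%N) : measurable_fun setT (c1 j) by case: (Hc1 j j3).
have c10 j (j3 : (3 <= j)%N) v : 0 <= c1 j v by case: (Hc1 j j3).
have mcS i (i2 : (2 <= i)%N) : measurable_fun setT (cS i) by case: (HcS i i2).
have cS0 i (i2 : (2 <= i)%N) v : 0 <= cS i v by case: (HcS i i2).
have mc i j (i2 : (2 <= i)%N) (ij : (i.+2 <= j)%N) : measurable_fun setT (c i j).
  by case: (Hc i j i2 ij).
have c0 i j (i2 : (2 <= i)%N) (ij : (i.+2 <= j)%N) v : 0 <= c i j v.
  by case: (Hc i j i2 ij).
rewrite (A_coefE ht Fn (Ftt t ht) Hf n mm1 m10 mm2 m20).
rewrite (B_coefE ht Fn (Ftt t ht) Hf n mc12 c120 mc1 c10 mcS cS0 mc c0).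
set p := count_prob P N t n.+1.
have p0 : 0 <= p by exact: measure_ge0.
have mean0 m G : (forall s, 0 <= G s) -> 0 <= order_statistic_mean f t m G.
  by move=> G0; apply: (order_statistic_mean_ge0 t Hf).
(* A single claim forms no pair: this is the case where the factor n(n-1) is 0. *)
pose first_two w : R := if (0 < n)%N then (X 1%N w * X 2%N w)%R else 0%R.
transitivity (\int[P]_(w in E n.+1)
  (X 1%N w ^+ 2 + \sum_(2 <= i < n.+2) X i w ^+ 2 +
   2%:R * (first_two w + \sum_(3 <= j < n.+2) X 1%N w * X j w
     + \sum_(2 <= i < n.+1) X i w * X i.+1 w
     + \sum_(2 <= i < n) \sum_(i.+2 <= j < n.+2) X i w * X j w))%:E).
  apply: eq_integral => w; rewrite inE => Ew.
  rewrite -/(S w) (SE _ _ Ew) sqr_sum_nat sum_pairs_split.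
  by rewrite (big_ltn (m := 1)).
have mfirst_two : measurable_fun setT first_two by rewrite /first_two; case: (0 < n)%N.
have first_two0 w : (0 <= first_two w)%R by rewrite /first_two; case: (0 < n)%N => //; exact: XX0.
have mX2 i : measurable_fun setT (fun w => X i w ^+ 2)%R by exact: measurable_funX.
have mfar i : measurable_fun setT (fun w => \sum_(i.+2 <= j < n.+2) X i w * X j w)%R.
  exact: measurable_sum.
have far0 i w : (2 <= i)%N -> (0 <= \sum_(i.+2 <= j < n.+2) X i w * X j w)%R.
  move=> i2; rewrite big_nat; apply: sumr_ge0 => j /andP[ij _].
  by apply: XX0; [exact: ltnW|apply: leq_trans ij].
have msum (a : nat -> Omega -> R) m l :
    (forall i, measurable_fun setT (a i)) ->
    measurable_fun setT (fun w => \sum_(m <= i < l) a i w)%R.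
  by move=> ma; exact: measurable_sum.
have sum0 (a : nat -> Omega -> R) m l w : (forall i, (m <= i)%N -> (0 <= a i w)%R) ->
    (0 <= \sum_(m <= i < l) a i w)%R.
  by move=> a0; rewrite big_nat; apply: sumr_ge0 => i /andP[/a0].
have s3 w : (0 <= \sum_(3 <= j < n.+2) X 1%N w * X j w)%R.
  apply: (sum0 (fun j w => X 1%N w * X j w)%R) => j j3; apply: XX0 => //; exact: leq_trans j3.
have s2 w : (0 <= \sum_(2 <= i < n.+1) X i w * X i.+1 w)%R.
  apply: (sum0 (fun i w => X i w * X i.+1 w)%R) => i i2; apply: XX0 => //; exact: leq_trans i2.
have s22 w : (0 <= \sum_(2 <= i < n) \sum_(i.+2 <= j < n.+2) X i w * X j w)%R.
  apply: (sum0 (fun i w => \sum_(i.+2 <= j < n.+2) X i w * X j w)%R) => i i2.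
  exact: far0.
have sq2 w : (0 <= \sum_(2 <= i < n.+2) X i w ^+ 2)%R.
  by apply: (sum0 (fun i w => X i w ^+ 2)%R) => i _; exact: sqr_ge0.
rewrite ge0_integralD_EFin//; first last.
- by move=> w; rewrite mulr_ge0// !addr_ge0.
- by move=> w; rewrite addr_ge0 ?sqr_ge0.
- by apply: measurable_funM => //; do 3 (apply: measurable_funD; last exact: msum).
- by apply: measurable_funD => //; exact: msum.
rewrite ge0_integralZl_real//; first last.
- by move=> w; rewrite !addr_ge0.
- by do 3 (apply: measurable_funD; last exact: msum).
rewrite !ge0_integralD_EFin//; first last.
all: try by move=> w; rewrite ?addr_ge0 ?sqr_ge0.
all: try by do 3 ((apply: measurable_funD; last exact: msum) || exact: msum || idtac).
rewrite !ge0_integral_sum_nat//; first last.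
all: try by move=> i w im; apply: XX0; lia.
all: try by move=> i w im; exact: sqr_ge0.
all: try by move=> i w im; exact: far0.
have m20' i : (2 <= i < n.+2)%N -> 0 <= order_statistic_mean f t n.+1
    (fun s => m2 i (nth 0%R s (i - 2), nth 0%R s (i - 1))).
  by move=> /andP[i2 _]; apply: mean0 => s; exact: m20.
have c10' j : (3 <= j < n.+2)%N -> 0 <= order_statistic_mean f t n.+1
    (fun s => c1 j (nth 0%R s 0, nth 0%R s (j - 2), nth 0%R s (j - 1))).
  by move=> /andP[j3 _]; apply: mean0 => s; exact: c10.
have cS0' i : (2 <= i < n.+1)%N -> 0 <= order_statistic_mean f t n.+1
    (fun s => cS i (nth 0%R s (i - 2), nth 0%R s (i - 1), nth 0%R s i)).
  by move=> /andP[i2 _]; apply: mean0 => s; exact: cS0.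
have c0' i j : (2 <= i < n)%N -> (i.+2 <= j < n.+2)%N ->
    0 <= order_statistic_mean f t n.+1
    (fun s => c i j (nth 0%R s (i - 2), nth 0%R s (i - 1),
                     nth 0%R s (j - 2), nth 0%R s (j - 1))).
  by move=> /andP[i2 _] /andP[ij _]; apply: mean0 => s; exact: c0.
have c0'' i : (2 <= i < n)%N -> 0 <= \sum_(i.+2 <= j < n.+2)
    order_statistic_mean f t n.+1
    (fun s => c i j (nth 0%R s (i - 2), nth 0%R s (i - 1),
                     nth 0%R s (j - 2), nth 0%R s (j - 1))).
  by move=> ir; apply: sume_nat_ge0 => j jr; exact: c0'.
rewrite [RHS]mule_squares_pairs; first last.
- exact: sume_nat_ge0.
- exact: sume_nat_ge0.
- exact: sume_nat_ge0.
- by case: (0 < n)%N => //; exact: mean0.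
- exact: sume_nat_ge0.
- exact: mean0.
have -> : \int[P]_(w in E n.+1) (first_two w)%:E =
    p * (if (0 < n)%N then order_statistic_mean f t n.+1
      (fun s => c12 (nth 0%R s 0, nth 0%R s 1)) else 0).
  rewrite /first_two; case: ltnP => [n0|_]; last by rewrite mule0 integral0.
  exact: (integral_first_two HN HOS ht Hf HX _ (HdepXX 1%N 2%N isT isT) Hc12).
rewrite (integral_first_square HN HOS ht Hf _ (HdepX 1%N isT) Hm1)//.
rewrite mule_sum_nat// mule_sum_nat// mule_sum_nat// mule_sum_nat//.
have -> : \sum_(2 <= i < n.+2) \int[P]_(w in E n.+1) (X i w ^+ 2)%:E =
    \sum_(2 <= i < n.+2) p * order_statistic_mean f t n.+1
      (fun s => m2 i (nth 0%R s (i - 2), nth 0%R s (i - 1))).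
  apply: eq_big_nat => i ir; have /andP[i2 _] := ir.
  exact: (integral_square HN HOS ht Hf ir (HdepX i (ltnW i2)) (Hm2 i i2)).
have -> : \sum_(3 <= j < n.+2) \int[P]_(w in E n.+1) (X 1%N w * X j w)%:E =
    \sum_(3 <= j < n.+2) p * order_statistic_mean f t n.+1
      (fun s => c1 j (nth 0%R s 0, nth 0%R s (j - 2), nth 0%R s (j - 1))).
  apply: eq_big_nat => j jr; have /andP[j3 _] := jr.
  exact: (integral_first_and_far HN HOS ht Hf HX jr (HdepXX 1%N j isT (ltnW j3)) (Hc1 j j3)).
have -> : \sum_(2 <= i < n.+1) \int[P]_(w in E n.+1) (X i w * X i.+1 w)%:E =
    \sum_(2 <= i < n.+1) p * order_statistic_mean f t n.+1
      (fun s => cS i (nth 0%R s (i - 2), nth 0%R s (i - 1), nth 0%R s i)).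
  apply: eq_big_nat => i ir; have /andP[i2 _] := ir.
  exact: (integral_neighbours HN HOS ht Hf HX ir (HdepXX i i.+1 (ltnW i2) (ltnSn i)) (HcS i i2)).
have -> : \sum_(2 <= i < n) \int[P]_(w in E n.+1)
      (\sum_(i.+2 <= j < n.+2) X i w * X j w)%:E =
    \sum_(2 <= i < n) p * \sum_(i.+2 <= j < n.+2) order_statistic_mean f t n.+1
      (fun s => c i j (nth 0%R s (i - 2), nth 0%R s (i - 1),
                       nth 0%R s (j - 2), nth 0%R s (j - 1))).
  apply: eq_big_nat => i ir; have /andP[i2 _] := ir.
  rewrite (@ge0_integral_sum_nat _ _ _ P _ (mE n.+1) (fun j w => X i w * X j w)%R)//; last first.
    by move=> j w ij; apply: XX0; lia.
  rewrite mule_sum_nat//; last by move=> j jr; exact: c0'.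
  apply: eq_big_nat => j jr; have /andP[ij _] := jr.
  exact: (integral_far HN HOS ht Hf HX i2 jr (HdepXX i j (ltnW i2) (ltnW ij)) (Hc i j i2 ij)).
by [].
Qed.
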